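(* There is a deterministic algorithm running in time polynomial in $m$ and $n$ with the following guarantee. Let $m \geq 16n$ and let $v_1, v_2, \dots, v_m \in S^{n-1}$ be unit vectors. The algorithm finds a vector $x \in S^{n-1}$ such that for all $i$, \[\langle v_i, x\rangle \leq \sqrt{\frac{2\ln\frac{m}{n}}{n}}\cdot\left(1+O\left(\frac{1}{\log\frac{m}{n}}\right)\right).\]
   Context: $S^{n-1} = \{x \in \mathbb{R}^n : \|x\|_2 = 1\}$. $\ln$ is the natural logarithm and $\log$ is base $2$. The implicit constant in $O(\cdot)$ is absolute (independent of $m$, $n$ and the input vectors). *)

(* Defs.v *)
From mathcomp Require Import all_boot all_order all_algebra.
From mathcomp Require Import reals exp.

Set Implicit Arguments.
Unset Strict Implicit.
Unset Printing Implicit Defensive.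

Import Order.TTheory GRing.Theory Num.Theory.
Local Open Scope ring_scope.

(** * Euclidean geometry *)

(* The norm that the analysis library puts on 'rV[R]_n is the sup norm, hence
   the explicit Euclidean one. *)
Definition dotp (R : realType) (n : nat) (u v : 'rV[R]_n) : R :=
  \sum_(j < n) u 0 j * v 0 j.

Definition norm2 (R : realType) (n : nat) (u : 'rV[R]_n) : R :=
  Num.sqrt (dotp u u).

Definition on_sphere (R : realType) (n : nat) (u : 'rV[R]_n) : Prop :=
  norm2 u = 1.

Definition log2 (R : realType) (x : R) : R := ln x / ln 2.

(** * The model of computation

  A real RAM, presented as a structured imperative language.  A store has
  natural-number registers and a random-access memory of real cells, addressed
  by an array name and two computed indices.  The real primitives are
  + - * / sqrt and exact comparison.  A program is a finite object whose only
  literals are natural numbers: no real constant can be hidden in it, and there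
  is no floor function or other map from the reals to the naturals except
  through comparisons.  Natural numbers have only addition and truncated
  subtraction, so that they cannot grow by more than a constant number of bits
  per unit of time. *)

Inductive nexp : Type :=
  | NConst of nat
  | NReg of nat
  | NAdd of nexp & nexp
  | NSub of nexp & nexp.

Inductive rexp : Type :=
  | RCast of nexp
  | RCell of nat & nexp & nexp
  | RAdd of rexp & rexp
  | RSub of rexp & rexp
  | RMul of rexp & rexp
  | RDiv of rexp & rexp
  | RSqrt of rexp.

Inductive bexp : Type :=
  | BNatLe of nexp & nexp
  | BRealLe of rexp & rexp
  | BNot of bexp
  | BAnd of bexp & bexp.

Inductive prog : Type :=
  | Skip
  | NSet of nat & nexp
  | RSet of nat & nexp & nexp & rexp
  | Seq of prog & prog
  | If of bexp & prog & prog
  | While of bexp & prog.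

Record store (R : realType) : Type := Store {
  nreg : nat -> nat;
  rmem : nat -> nat -> nat -> R
}.

Definition set_nreg (R : realType) (s : store R) (r k : nat) : store R :=
  Store (fun r' => if r' == r then k else nreg s r') (rmem s).

Definition set_rmem (R : realType) (s : store R) (a i j : nat) (x : R) :
    store R :=
  Store (nreg s)
    (fun a' i' j' =>
       if [&& a' == a, i' == i & j' == j] then x else rmem s a' i' j').

Fixpoint neval (R : realType) (s : store R) (e : nexp) : nat :=
  match e with
  | NConst k => k
  | NReg r => nreg s r
  | NAdd e1 e2 => (neval s e1 + neval s e2)%N
  | NSub e1 e2 => (neval s e1 - neval s e2)%N
  end.

(* Division by zero and square roots of negative numbers return 0; a program
   can test for these cases beforehand. *)
Fixpoint reval (R : realType) (s : store R) (e : rexp) : R :=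
  match e with
  | RCast e1 => (neval s e1)%:R
  | RCell a i j => rmem s a (neval s i) (neval s j)
  | RAdd e1 e2 => reval s e1 + reval s e2
  | RSub e1 e2 => reval s e1 - reval s e2
  | RMul e1 e2 => reval s e1 * reval s e2
  | RDiv e1 e2 => reval s e1 / reval s e2
  | RSqrt e1 => Num.sqrt (reval s e1)
  end.

Fixpoint beval (R : realType) (s : store R) (b : bexp) : bool :=
  match b with
  | BNatLe e1 e2 => (neval s e1 <= neval s e2)%N
  | BRealLe e1 e2 => reval s e1 <= reval s e2
  | BNot b1 => ~~ beval s b1
  | BAnd b1 b2 => beval s b1 && beval s b2
  end.

(* Unit cost: one time unit per node of an evaluated expression, plus one per
   executed command or loop test. *)
Fixpoint ncost (e : nexp) : nat :=
  match e with
  | NConst _ | NReg _ => 1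
  | NAdd e1 e2 | NSub e1 e2 => (ncost e1 + ncost e2).+1
  end.

Fixpoint rcost (e : rexp) : nat :=
  match e with
  | RCast e1 => (ncost e1).+1
  | RCell _ i j => (ncost i + ncost j).+1
  | RAdd e1 e2 | RSub e1 e2 | RMul e1 e2 | RDiv e1 e2 =>
      (rcost e1 + rcost e2).+1
  | RSqrt e1 => (rcost e1).+1
  end.

Fixpoint bcost (b : bexp) : nat :=
  match b with
  | BNatLe e1 e2 => (ncost e1 + ncost e2).+1
  | BRealLe e1 e2 => (rcost e1 + rcost e2).+1
  | BNot b1 => (bcost b1).+1
  | BAnd b1 b2 => (bcost b1 + bcost b2).+1
  end.

(* [exec p s t s']: started in s, the program p halts in s' after t steps. *)
Inductive exec (R : realType) : prog -> store R -> nat -> store R -> Prop :=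
  | ExecSkip s :
      exec Skip s 1 s
  | ExecNSet s r e :
      exec (NSet r e) s (ncost e).+1 (set_nreg s r (neval s e))
  | ExecRSet s a i j e :
      exec (RSet a i j e) s (ncost i + ncost j + rcost e).+1
        (set_rmem s a (neval s i) (neval s j) (reval s e))
  | ExecSeq p q s t s1 u s2 :
      exec p s t s1 -> exec q s1 u s2 ->
      exec (Seq p q) s (t + u).+1 s2
  | ExecIfTrue b p q s t s1 :
      beval s b -> exec p s t s1 ->
      exec (If b p q) s (bcost b + t).+1 s1
  | ExecIfFalse b p q s t s1 :
      ~~ beval s b -> exec q s t s1 ->
      exec (If b p q) s (bcost b + t).+1 s1
  | ExecWhileFalse b p s :
      ~~ beval s b ->
      exec (While b p) s (bcost b).+1 s
  | ExecWhileTrue b p s t s1 u s2 :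
      beval s b -> exec p s t s1 -> exec (While b p) s1 u s2 ->
      exec (While b p) s (bcost b + t + u).+1 s2.

Lemma exec_deterministic (R : realType) (p : prog) (s : store R) t1 s1 t2 s2 :
  exec p s t1 s1 -> exec p s t2 s2 -> t1 = t2 /\ s1 = s2.
Proof.
move=> H; elim: H t2 s2 => {p s t1 s1}.
- by move=> s t2 s2 H; inversion H.
- by move=> s r e t2 s2 H; inversion H.
- by move=> s a i j e t2 s2 H; inversion H.
- move=> p q s t s1 u s2 _ IHp _ IHq t' s' H; inversion H; subst.
  have [? ?] := IHp _ _ ltac:(eassumption); subst.
  by have [? ?] := IHq _ _ ltac:(eassumption); subst.
- move=> b p q s t s1 hb _ IH t' s' H; inversion H; subst.
    by have [? ?] := IH _ _ ltac:(eassumption); subst.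
  by exfalso; move: hb; apply/negP.
- move=> b p q s t s1 hb _ IH t' s' H; inversion H; subst.
    by exfalso; move/negP: hb; apply.
  by have [? ?] := IH _ _ ltac:(eassumption); subst.
- move=> b p s hb t' s' H; inversion H; subst => //.
  by exfalso; move/negP: hb; apply.
- move=> b p s t s1 u s2 hb _ IHp _ IHw t' s' H; inversion H; subst.
    by exfalso; move: hb; apply/negP.
  have [? ?] := IHp _ _ ltac:(eassumption); subst.
  by have [? ?] := IHw _ _ ltac:(eassumption); subst.
Qed.

(* The input: m and n in registers 0 and 1, and the coordinates of the vectors
   (the rows of V) in array 0; everything else is 0. *)
Definition input_store (R : realType) (m n : nat) (V : 'M[R]_(m, n)) :
    store R :=
  Store
    (fun r => match r with 0%N => m | 1%N => n | _ => 0%N end)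
    (fun a i j =>
       match a, (insub i : option 'I_m), (insub j : option 'I_n) with
       | 0%N, Some i', Some j' => V i' j'
       | _, _, _ => 0
       end).

(* The output vector is read off row 0 of array 1. *)
Definition output_vector (R : realType) (n : nat) (s : store R) : 'rV[R]_n :=
  \row_(j < n) rmem s 1%N 0%N j.

(* Main.v *)
Require Import Defs.
From mathcomp Require Import all_boot all_order all_algebra.
From mathcomp Require Import boolp classical_sets reals topology normedtype.
From mathcomp Require Import sequences derive exp zify ring lra.
Import Order.TTheory GRing.Theory Num.Theory numFieldNormedType.Exports.

Set Implicit Arguments.
Unset Strict Implicit.
Unset Printing Implicit Defensive.

(* A multiplicative-weights walk.  Put [L = ln (m/n)] and start from [x = 0] with
   all weights [w_i = 1].  Each of [n^4] steps moves [x] by [y / n^2] for a unit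
   vector [y] orthogonal to [x] (so that [|x|^2] grows linearly to 1), to
   [sum_i w_i v_i], and to every [v_i] whose weight exceeds a fixed threshold
   [theta], a constant times [(m/n)^2]; then [w_i] is multiplied by a quadratic
   upper bound of [exp (eta <v_i, y>)], where [eta^2 = 2 L / n^3], so that always
   [w_i >= exp (sqrt (2 L n) <v_i, x>)].  A weight that exceeds [theta] stays
   constant from then on, hence every weight is at most [3 theta], and at the end
   [sqrt (2 L n) <v_i, x> <= 2 L + O(1)], which is the claim.

   For such a [y] to exist with a small second moment, few vectors may be frozen.
   Averaging over the rows of the orthogonal projection onto the allowed
   directions, some [y] multiplies the total weight [F] by at most
   [1 + (L / n^4) (1 + eta) n / (n - 2 - F / theta)], because at most [F / theta]
   weights exceed [theta].  This is a discrete logistic equation, whose solution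
   stays of order [m exp (L t / n^4) <= m^2 / n], so [F / theta <= n / 6].

   The number [L] is replaced by the harmonic sum of [1/j] for [n <= j < m], which
   exceeds it by at most [1/n].  If [2 L >= n] or [n < 8], any unit vector will do. *)


(** * Loop programs *)

(** A fragment with counted loops only: it always halts, and a time bound can be read off the
    syntax. [LFor r b p] runs [r] through the numbers below the value of register [b]. *)
Inductive lprog : Type :=
  | LSkip
  | LSet of nat & nexp & nexp & rexp
  | LSeq of lprog & lprog
  | LIf of bexp & lprog & lprog
  | LFor of nat & nat & lprog.

Fixpoint compile (p : lprog) : prog :=
  match p with
  | LSkip => Skip
  | LSet a i j e => RSet a i j e
  | LSeq p1 p2 => Seq (compile p1) (compile p2)
  | LIf b p1 p2 => If b (compile p1) (compile p2)
  | LFor r b p1 =>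
      Seq (NSet r (NConst 0))
        (While (BNatLe (NAdd (NReg r) (NConst 1)) (NReg b))
           (Seq (compile p1) (NSet r (NAdd (NReg r) (NConst 1)))))
  end.

Definition memory (R : realType) := nat -> nat -> nat -> R.

Definition upd_env (g : nat -> nat) (r k : nat) : nat -> nat :=
  fun r' => if r' == r then k else g r'.

Definition upd_mem (R : realType) (M : memory R) (a i j : nat) (x : R) : memory R :=
  fun a' i' j' => if [&& a' == a, i' == i & j' == j] then x else M a' i' j'.

(** Registers change only as loop counters, so they are passed down as an environment and only the
    memory is threaded through. *)
Fixpoint den (R : realType) (p : lprog) (g : nat -> nat) (M : memory R) : memory R :=
  match p with
  | LSkip => M
  | LSet a i j e =>
      let s := Store g M in upd_mem M a (neval s i) (neval s j) (reval s e)
  | LSeq p1 p2 => den p2 g (den p1 g M)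
  | LIf b p1 p2 => if beval (Store g M) b then den p1 g M else den p2 g M
  | LFor r b p1 => iteri (g b) (fun k M' => den p1 (upd_env g r k) M') M
  end.

Fixpoint nscoped (c : seq nat) (e : nexp) : bool :=
  match e with
  | NConst _ => true
  | NReg r => r \in c
  | NAdd e1 e2 | NSub e1 e2 => nscoped c e1 && nscoped c e2
  end.

Fixpoint rscoped (c : seq nat) (e : rexp) : bool :=
  match e with
  | RCast e1 => nscoped c e1
  | RCell _ i j => nscoped c i && nscoped c j
  | RAdd e1 e2 | RSub e1 e2 | RMul e1 e2 | RDiv e1 e2 =>
      rscoped c e1 && rscoped c e2
  | RSqrt e1 => rscoped c e1
  end.

Fixpoint bscoped (c : seq nat) (b : bexp) : bool :=
  match b with
  | BNatLe e1 e2 => nscoped c e1 && nscoped c e2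
  | BRealLe e1 e2 => rscoped c e1 && rscoped c e2
  | BNot b1 => bscoped c b1
  | BAnd b1 b2 => bscoped c b1 && bscoped c b2
  end.

(** Counters are fresh, so no loop body overwrites a bound or an enclosing counter; [b < 2]
    restricts bounds to the registers of [m] and [n]. *)
Fixpoint scoped (c : seq nat) (p : lprog) : bool :=
  match p with
  | LSkip => true
  | LSet _ i j e => [&& nscoped c i, nscoped c j & rscoped c e]
  | LSeq p1 p2 => scoped c p1 && scoped c p2
  | LIf b p1 p2 => [&& bscoped c b, scoped c p1 & scoped c p2]
  | LFor r b p1 => [&& r \notin c, b \in c, (b < 2)%N & scoped (r :: c) p1]
  end.

Fixpoint depth (p : lprog) : nat :=
  match p with
  | LSkip | LSet _ _ _ _ => 0
  | LSeq p1 p2 | LIf _ p1 p2 => maxn (depth p1) (depth p2)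
  | LFor _ _ p1 => (depth p1).+1
  end.

(** The 11 is the overhead of one loop iteration: test, increment and sequencing. *)
Fixpoint coef (p : lprog) : nat :=
  match p with
  | LSkip => 1
  | LSet _ i j e => (ncost i + ncost j + rcost e).+1
  | LSeq p1 p2 => (coef p1 + coef p2).+1
  | LIf b p1 p2 => (bcost b + coef p1 + coef p2).+1
  | LFor _ _ p1 => (coef p1 + 11)%N
  end.

Section Compile.
Variable R : realType.
Implicit Types (s : store R) (g : nat -> nat) (M : memory R) (c : seq nat).

Lemma neval_scoped c s g M e :
  {in c, nreg s =1 g} -> nscoped c e -> neval s e = neval (Store g M) e.
Proof.
move=> H; by elim: e => //= e1 IH1 e2 IH2 /andP[/IH1 -> /IH2 ->].
Qed.

Lemma reval_scoped c s g e :
  {in c, nreg s =1 g} -> rscoped c e ->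
  reval s e = reval (Store g (rmem s)) e.
Proof.
move=> H; elim: e => //=.
- by move=> e /(neval_scoped (rmem s) H) ->.
- by move=> a i j /andP[/(neval_scoped (rmem s) H) -> /(neval_scoped (rmem s) H) ->].
- by move=> e1 IH1 e2 IH2 /andP[/IH1 -> /IH2 ->].
- by move=> e1 IH1 e2 IH2 /andP[/IH1 -> /IH2 ->].
- by move=> e1 IH1 e2 IH2 /andP[/IH1 -> /IH2 ->].
- by move=> e1 IH1 e2 IH2 /andP[/IH1 -> /IH2 ->].
- by move=> e IH /IH ->.
Qed.

Lemma beval_scoped c s g b :
  {in c, nreg s =1 g} -> bscoped c b ->
  beval s b = beval (Store g (rmem s)) b.
Proof.
move=> H; elim: b => //=.
- by move=> e1 e2 /andP[/(neval_scoped (rmem s) H) -> /(neval_scoped (rmem s) H) ->].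
- by move=> e1 e2 /andP[/(reval_scoped H) -> /(reval_scoped H) ->].
- by move=> b IH /IH ->.
- by move=> b1 IH1 b2 IH2 /andP[/IH1 -> /IH2 ->].
Qed.

(** Induction on the program. As [N] strictly exceeds the loop bounds, initialising a loop and its
    last, failing test are charged as one extra iteration. *)
Lemma exec_compile (N : nat) p c s g :
  {in c, nreg s =1 g} -> scoped c p ->
  (forall b, (b < 2)%N -> (g b < N)%N) ->
  exists t s', [/\ exec (compile p) s t s', rmem s' = den p g (rmem s),
    {in c, nreg s' =1 g} & (t <= coef p * N ^ depth p)%N].
Proof.
have N_gt0 (g' : nat -> nat) : (forall b, (b < 2)%N -> (g' b < N)%N) -> (0 < N)%N.
  by move=> /(_ 0%N isT); apply: leq_trans.
elim: p c s g => /=.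
- move=> c s g H _ _; exists 1%N, s; split => //; exact: ExecSkip.
- move=> a i j e c s g H /and3P[Hi Hj He] _; do 2 eexists; split.
  + exact: ExecRSet.
  + by rewrite /= (neval_scoped (rmem s) H Hi) (neval_scoped (rmem s) H Hj)
      (reval_scoped H He).
  + by [].
  + by rewrite expn0 muln1.
- move=> p1 IH1 p2 IH2 c s g H /andP[S1 S2] B.
  have [t1 [s1 [E1 D1 H1 T1]]] := IH1 _ _ _ H S1 B.
  have [t2 [s2 [E2 D2 H2 T2]]] := IH2 _ _ _ H1 S2 B.
  exists (t1 + t2).+1, s2; split=> //.
  + exact: ExecSeq E1 E2.
  + by rewrite D2 D1.
  + have N0 := N_gt0 _ B.
    rewrite mulSn mulnDl -addn1 addnC leq_add ?expn_gt0 ?N0 // leq_add //.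
      by rewrite (leq_trans T1) // leq_mul2l leq_pexp2l ?leq_maxl ?orbT.
    by rewrite (leq_trans T2) // leq_mul2l leq_pexp2l ?leq_maxr ?orbT.
- move=> b p1 IH1 p2 IH2 c s g H /and3P[Sb S1 S2] B.
  have N0 := N_gt0 _ B.
  have Nge d : (0 < N ^ d)%N by rewrite expn_gt0 N0.
  rewrite -(beval_scoped H Sb); case E : (beval s b).
    have [t1 [s1 [E1 D1 H1 T1]]] := IH1 _ _ _ H S1 B.
    exists (bcost b + t1).+1, s1; split=> //; first exact: ExecIfTrue.
    rewrite -!addSn mulnDl (leq_trans _ (leq_addr _ _)) //.
    rewrite mulnDl leq_add //; first by rewrite leq_pmulr.
    by rewrite (leq_trans T1) // leq_mul2l leq_pexp2l ?leq_maxl ?orbT.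
  have [t1 [s1 [E1 D1 H1 T1]]] := IH2 _ _ _ H S2 B.
  exists (bcost b + t1).+1, s1; split=> //; first by apply: ExecIfFalse; rewrite ?E.
  rewrite addnAC -!addSn mulnDl (leq_trans _ (leq_addr _ _)) //.
  rewrite mulnDl leq_add //; first by rewrite leq_pmulr.
  by rewrite (leq_trans T1) // leq_mul2l leq_pexp2l ?leq_maxr ?orbT.
- move=> r b p IH c s g H /and4P[rc bc b2 Sp] B.
  have N0 := N_gt0 _ B.
  have Nge d : (0 < N ^ d)%N by rewrite expn_gt0 N0.
  have br : b != r by apply: contraNneq rc => <-.
  have r2 : forall k, forall b, (b < 2)%N -> (upd_env g r k b < N)%N \/ b = r.
    by move=> k b' /B; rewrite /upd_env; case: eqP; [right|left].
  set loop := While _ _.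
  pose F k M := den p (upd_env g r k) M.
  have L : forall k j s1, (j + k = g b)%N -> nreg s1 r = j ->
      {in c, nreg s1 =1 g} -> rmem s1 = iteri j F (rmem s) ->
      exists t s', [/\ exec loop s1 t s', rmem s' = iteri (g b) F (rmem s),
        {in c, nreg s' =1 g} & (t <= k * (coef p * N ^ depth p + 11) + 6)%N].
    elim=> [|k IHk] j s1 jk s1r s1c s1m.
      exists 6%N, s1; split=> //.
        by apply: ExecWhileFalse; rewrite /= s1r s1c // -jk addn0 addn1 ltnn.
      by rewrite s1m -jk addn0.
    have Hin : {in r :: c, nreg s1 =1 upd_env g r j}.
      move=> x; rewrite inE /upd_env; case: eqP => [-> //|_ /= xc].
      exact: s1c.
    have Hb : forall b, (b < 2)%N -> (upd_env g r j b < N)%N.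
      move=> b' /B; rewrite /upd_env; case: eqP => // _ _.
      by apply: leq_trans (B _ b2); rewrite ltnS -jk leq_addr.
    have [t1 [s2 [E1 D1 H1 T1]]] := IH _ _ _ Hin Sp Hb.
    have s2r : nreg s2 r = j by rewrite H1 ?inE ?eqxx // /upd_env eqxx.
    pose s3 := set_nreg s2 r (neval s2 (NAdd (NReg r) (NConst 1))).
    have [||||t3 [s4 [E4 M4 C4 T4]]] := IHk j.+1 s3.
    + by rewrite -jk addSnnS.
    + by rewrite /= eqxx s2r addn1.
    + move=> x xc /=; case: eqP xc => [-> xc|/eqP xr xc].
        by rewrite xc in rc.
      by rewrite H1 ?inE ?xc ?orbT // /upd_env (negbTE xr).
    + by rewrite /= D1 s1m.
    exists (5 + (t1 + 4).+1 + t3).+1, s4; split=> //.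
      apply: (ExecWhileTrue _ _ E4); last exact: (ExecSeq E1 (ExecNSet _ _ _)).
      by rewrite /= s1r s1c // -jk addn1 addnS ltnS leq_addr.
    by rewrite mulSn; lia.
  have [||||t1 [s1 [E1 M1 C1 T1]]] := L (g b) 0%N (set_nreg s r 0).
  + by [].
  + by rewrite /= eqxx.
  + move=> x xc /=; case: eqP xc => [-> xc|_ xc]; last exact: H.
    by rewrite xc in rc.
  + by [].
  exists (2 + t1).+1, s1; split=> //.
    by refine (ExecSeq (t := 2) _ E1); apply: (ExecNSet _ _ (NConst 0)).
  have gN := B _ b2.
  apply: leq_trans (_ : (g b).+1 * (coef p * N ^ depth p + 11) <= _)%N.
    by rewrite mulSn; lia.
  rewrite expnS mulnCA leq_mul // mulnDl leq_add2l.
  by rewrite leq_pmulr.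
Qed.

End Compile.

Local Open Scope ring_scope.

(** * Real estimates *)

Section RealEstimates.
Variable R : realType.

(** Yields the Taylor bounds of [expR (- b)] one after the other: each is the derivative condition
    for the next. *)
Lemma ge0_of_derive_ge0 (f df : R -> R) (b : R) :
  f 0 = 0 -> (forall x : R, is_derive x (1 : R) f (df x)) ->
  (forall x, 0 <= x -> 0 <= df x) -> 0 <= b -> 0 <= f b.
Proof.
move=> f0 fd df0 b0.
have [|c] := MVT_segment b0 (fun x _ => fd x).
  apply: continuous_subspaceT => x.
  by apply/differentiable_continuous/derivable1_diffP; case: (fd x).
rewrite in_itv /= f0 !subr0 => /andP[c0 _] ->.
by rewrite mulr_ge0 ?df0.
Qed.

Lemma expRN_le_quad (b : R) : 0 <= b -> expR (- b) <= 1 - b + b ^+ 2 / 2.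
Proof.
move=> b0; rewrite -subr_ge0.
apply: (@ge0_of_derive_ge0
  (fun x => 1 - x + x ^+ 2 / 2 - expR (- x)) (fun x => expR (- x) - (1 - x))) => //.
- by rewrite oppr0 expR0; field.
- move=> x; apply: is_derive_eq.
  by rewrite /GRing.scale /=; field.
- by move=> x _; rewrite subr_ge0 expR_ge1Dx.
Qed.

Lemma expRN_ge_cubic (b : R) :
  0 <= b -> 1 - b + b ^+ 2 / 2 - b ^+ 3 / 6 <= expR (- b).
Proof.
move=> b0; rewrite -subr_ge0.
apply: (@ge0_of_derive_ge0
  (fun x => expR (- x) - (1 - x + x ^+ 2 / 2 - x ^+ 3 / 6))
  (fun x => 1 - x + x ^+ 2 / 2 - expR (- x))) => //.
- by rewrite oppr0 expR0; field.
- move=> x; apply: is_derive_eq.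
  by rewrite /GRing.scale /=; field.
- by move=> x x0; rewrite subr_ge0 expRN_le_quad.
Qed.

Lemma expR_le_quad (eta a : R) : eta <= 1 -> `|a| <= eta ->
  expR a <= 1 + a + a ^+ 2 / 2 * (1 + eta).
Proof.
move=> eta1 aeta; have eta0 : 0 <= eta by apply: le_trans aeta.
have [a0|/ltW a0] := leP 0 a; last first.
  rewrite -[a]opprK; set b := - a; have b0 : 0 <= b by rewrite oppr_ge0.
  by have := expRN_le_quad b0; nra.
rewrite ger0_norm // in aeta.
have a1 : a <= 1 by apply: le_trans eta1.
have := expRN_ge_cubic a0; set c := (X in X <= _) => cE.
(* Multiplying by the lower bound [c] of [expR (- a)] leaves a polynomial inequality, which is
   checked with [a] in place of [eta]. *)
suff H : 1 <= (1 + a + a ^+ 2 / 2 * (1 + eta)) * c.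
  have e0 := expR_gt0 a.
  have p0 : 0 <= 1 + a + a ^+ 2 / 2 * (1 + eta).
    by rewrite !addr_ge0 // mulr_ge0 // ?divr_ge0 ?sqr_ge0 ?addr_ge0.
  have := le_trans H (ler_wpM2l p0 cE).
  by rewrite expRN ler_pdivlMr // mul1r.
have c0 : 0 <= c by rewrite /c; nra.
apply: (@le_trans _ _ ((1 + a + a ^+ 2 / 2 * (1 + a)) * c)).
  rewrite -subr_ge0.
  have -> : (1 + a + a ^+ 2 / 2 * (1 + a)) * c - 1 =
    a ^+ 3 * (1 - a) * (4 - a + a ^+ 2) / 12 by rewrite /c; field.
  by rewrite divr_ge0 // !mulr_ge0 ?exprn_ge0 ?subr_ge0 //; nra.
apply: ler_wpM2r => //; rewrite lerD2l ler_wpM2l ?divr_ge0 ?sqr_ge0 //.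
by rewrite lerD2l.
Qed.

Lemma expR1_le3 : expR 1 <= 3 :> R.
Proof.
have h : expR (8%:R^-1) <= 8 / 7 :> R.
  have := expR_ge1Dx (- 8%:R^-1 : R).
  rewrite expRN -[leRHS]mul1r ler_pdivlMr ?expR_gt0 //; lra.
have -> : (1 : R) = 8%:R * 8%:R^-1 by field.
rewrite expRM_natl (le_trans (lerXn2r 8 _ _ h)) ?nnegrE ?expR_ge0 ?divr_ge0 //.
by lra.
Qed.

(** Telescoping of [1/(j+1) <= ln ((j+1)/j) <= 1/j]; the term [- m%:R^-1] lets the induction close.
    The sum is computable by a machine without logarithms. *)
Lemma harmonic_ln_bounds (n m : nat) : (0 < n)%N -> (n <= m)%N ->
  ln (m%:R / n%:R) <= \sum_(n <= j < m) (j%:R^-1 : R)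
    <= ln (m%:R / n%:R) + n%:R^-1 - m%:R^-1.
Proof.
move=> n0; elim: m => [|m IH]; first by rewrite leqn0 => /eqP n0'; rewrite n0' in n0.
rewrite leq_eqVlt => /predU1P[<-|nm].
  by rewrite divff ?pnatr_eq0 ?lt0n_neq0 // ln1 big_geq // lexx /=; lra.
have {IH} /andP[IH1 IH2] := IH nm.
rewrite big_nat_recr //=.
have n0R : 0 < n%:R :> R by rewrite ltr0n.
have m0R : 0 < m%:R :> R by rewrite ltr0n (leq_trans n0).
have m1R : 0 < m.+1%:R :> R by rewrite ltr0n.
rewrite !ln_div ?posrE // in IH1 IH2 *.
have u : ln m.+1%:R - ln m%:R <= m%:R^-1 :> R.
  rewrite -ln_div ?posrE // (_ : m.+1%:R / m%:R = 1 + m%:R^-1).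
    by apply: le_ln1Dx; apply: lt_trans (_ : 0 < _); rewrite ?invr_gt0 //; lra.
  by rewrite -natr1 mulrDl divff ?gt_eqF // mul1r.
have l : ln m%:R - ln m.+1%:R <= - m.+1%:R^-1 :> R.
  rewrite -ln_div ?posrE // (_ : m%:R / m.+1%:R = 1 + - m.+1%:R^-1).
    apply: le_ln1Dx; rewrite ltrN2 invf_lt1 // -[1]/(1%:R) ltr_nat ltnS.
    exact: leq_trans n0 nm.
  by rewrite -[in LHS](addrK 1 m%:R) natr1 mulrBl divff ?gt_eqF // mul1r.
by move: (m.+1%:R^-1) (ln m.+1%:R) u l => B A u l; apply/andP; split; lra.
Qed.

End RealEstimates.

(** * Orthogonal projections *)

Section Projections.
Variables (R : realType) (n : nat).
Implicit Types (u v c : 'rV[R]_n) (P : 'M[R]_n).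

Lemma dotpE u v : dotp u v = (u *m v^T) 0 0.
Proof. by rewrite mxE; apply: eq_bigr => j _; rewrite mxE. Qed.

Lemma dotpC u v : dotp u v = dotp v u.
Proof. by apply: eq_bigr => j _; rewrite mulrC. Qed.

Lemma dotpDr u v c : dotp u (v + c) = dotp u v + dotp u c.
Proof. by rewrite -big_split; apply: eq_bigr => j _; rewrite mxE mulrDr. Qed.

Lemma dotpZr (a : R) u v : dotp u (a *: v) = a * dotp u v.
Proof. by rewrite mulr_sumr; apply: eq_bigr => j _; rewrite mxE mulrCA. Qed.

Lemma dotp_ge0 u : 0 <= dotp u u.
Proof. by apply: sumr_ge0 => j _; rewrite -expr2 sqr_ge0. Qed.

Lemma dotp_eq0 u : dotp u u = 0 -> u = 0.
Proof.
move/eqP; rewrite psumr_eq0; last by move=> j _; rewrite -expr2 sqr_ge0.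
move/allP => H; apply/rowP => j; rewrite mxE.
have := H j (mem_index_enum j); rewrite /= -expr2 sqrf_eq0 => /eqP //.
Qed.

Lemma dotpDD u v : dotp (u + v) (u + v) = dotp u u + 2 * dotp u v + dotp v v.
Proof.
rewrite dotpDr dotpC dotpDr (dotpC (u + v)) dotpDr (dotpC v u) mulr_natl mulr2n.
by rewrite !addrA.
Qed.

Lemma CauchySchwarz_unit u v :
  dotp u u = 1 -> dotp v v = 1 -> `|dotp u v| <= 1.
Proof.
move=> uu vv; rewrite ler_norml.
have := dotp_ge0 (u + v); rewrite dotpDD uu vv.
have := dotp_ge0 (u + (-1) *: v).
by rewrite dotpDD !dotpZr [dotp (_ *: _) v]dotpC dotpZr uu vv; lra.
Qed.

Definition is_proj P := P^T = P /\ P *m P = P.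

(** A Gram-Schmidt step that restricts the range of [P] to the complement of [c]. The test
    [dotp u u <= 0] means [u = 0]: then [c] is already orthogonal to the range. *)
Definition project_out P c : 'M[R]_n :=
  let u := c *m P in
  if dotp u u <= 0 then P else P - (dotp u u)^-1 *: (u^T *m u).

Variables (P : 'M[R]_n) (c : 'rV[R]_n).
Hypothesis projP : is_proj P.

Let u := c *m P.

Let uP : u *m P = u.
Proof. by case: projP => _ PP; rewrite /u -mulmxA PP. Qed.

Let Pu : P *m u^T = u^T.
Proof. by case: projP => PT _; rewrite -{1}PT -trmx_mul uP. Qed.

Let uu : u *m u^T = (dotp u u)%:M.
Proof. by rewrite [LHS]mx11_scalar dotpE. Qed.

Lemma project_out_is_proj : is_proj (project_out P c).
Proof.
case: projP => PT PP; rewrite /project_out -/u; case: ifPn => // N0.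
rewrite -ltNge in N0; split.
  by rewrite linearB linearZ /= trmx_mul trmxK PT.
have PA : P *m (u^T *m u) = u^T *m u by rewrite mulmxA Pu.
have AP : (u^T *m u) *m P = u^T *m u by rewrite -mulmxA uP.
have AA : (dotp u u)^-1 *: ((u^T *m u) *m (u^T *m u)) = u^T *m u.
  rewrite -mulmxA [u *m (_ *m _)]mulmxA uu mul_scalar_mx -scalemxAr scalerA.
  by rewrite mulVf ?gt_eqF // scale1r.
rewrite mulmxBl !mulmxBr PP -!scalemxAl -!scalemxAr PA AP AA.
by rewrite subrr subr0.
Qed.

Lemma mulmx_project_out : c *m project_out P c = 0.
Proof.
case: projP => PT PP; rewrite /project_out -/u; case: ifPn => N0.
  by apply: dotp_eq0; apply/eqP; rewrite eq_le N0 dotp_ge0.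
rewrite -ltNge in N0.
have cu : c *m u^T = (dotp u u)%:M.
  rewrite -uu /u trmx_mul PT mulmxA -[in RHS]mulmxA [P *m (_ *m _)]mulmxA.
  by rewrite PP mulmxA.
rewrite mulmxBr -scalemxAr mulmxA cu mul_scalar_mx scalerA mulVf ?gt_eqF //.
by rewrite scale1r subrr.
Qed.

Lemma mulmx_project_out_eq0 (b : 'rV[R]_n) :
  b *m P = 0 -> b *m project_out P c = 0.
Proof.
case: projP => PT PP bP; rewrite /project_out -/u; case: ifPn => // N0.
rewrite mulmxBr -scalemxAr mulmxA bP /u trmx_mul PT mulmxA bP.
by rewrite !mul0mx scaler0 subr0.
Qed.

(** The trace is the dimension of the range, and the rank-one term that is removed has trace 1. *)
Lemma mxtrace_project_out : \tr P - 1 <= \tr (project_out P c).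
Proof.
rewrite /project_out -/u; case: ifPn => N0; first by lra.
rewrite -ltNge in N0.
rewrite linearB linearZ /= mxtrace_mulC uu mxtrace_scalar mulVf ?gt_eqF //.
Qed.

Lemma dotp_row_proj (b : 'rV[R]_n) j : dotp b (row j P) = (b *m P) 0 j.
Proof.
case: projP => PT _; rewrite -{2}PT mxE; apply: eq_bigr => k _.
by rewrite !mxE.
Qed.

Lemma dotp_row_proj_self j : dotp (row j P) (row j P) = P j j.
Proof. by rewrite dotp_row_proj -row_mul mxE; case: projP => _ ->. Qed.

Lemma dotp_proj_le (v : 'rV[R]_n) : dotp (v *m P) (v *m P) <= dotp v v.
Proof.
case: projP => PT PP.
have h : dotp v (v *m P) = dotp (v *m P) (v *m P).
  by rewrite !dotpE trmx_mul PT !mulmxA -[v *m P *m P]mulmxA PP.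
have := dotp_ge0 (v + (-1) *: (v *m P)).
by rewrite dotpDD !dotpZr h [dotp (_ *: _) _]dotpC dotpZr; lra.
Qed.

(** Averaging over the rows: their squared norms [P j j] add up to the trace, their second moments
    to at most the total weight. Asking for [0 < P j j] allows the row to be normalised. *)
Lemma exists_low_variance_row (m : nat) (V : 'M[R]_(m, n)) (w : 'I_m -> R) :
  (forall i, 0 <= w i) -> (forall i, dotp (row i V) (row i V) = 1) ->
  0 < \tr P ->
  exists j, 0 < P j j /\ (\sum_i w i * dotp (row i V) (row j P) ^+ 2) * \tr P
      <= (\sum_i w i) * P j j.
Proof.
move=> w0 V1 tr0; apply: contrapT => H.
pose Q j := \sum_i w i * dotp (row i V) (row j P) ^+ 2.
have Q0 j : 0 <= Q j by apply: sumr_ge0 => i _; rewrite mulr_ge0 ?sqr_ge0.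
have sumQ : \sum_j Q j <= \sum_i w i.
  rewrite exchange_big; apply: ler_sum => i _ /=.
  rewrite -mulr_sumr ler_piMr // -(V1 i).
  apply: le_trans (dotp_proj_le _); rewrite le_eqVlt; apply/orP; left; apply/eqP.
  by apply: eq_bigr => j _; rewrite dotp_row_proj -expr2.
have P0 j : 0 <= P j j by rewrite -dotp_row_proj_self dotp_ge0.
have D0 j : 0 <= Q j * \tr P - (\sum_i w i) * P j j.
  rewrite subr_ge0; have [Pj|Pj] := ltP 0 (P j j); last first.
    have -> : P j j = 0 by apply/le_anti; rewrite Pj P0.
    by rewrite mulr0 mulr_ge0 // ltW.
  rewrite leNgt; apply/negP => /ltW h; apply: H; exists j; split=> //.
(* If every row failed, these nonnegative differences would have a nonpositive sum, hence vanish,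
   and any row with [0 < P j j] would do. *)
have /psumr_eq0P S : \sum_j (Q j * \tr P - (\sum_i w i) * P j j) = 0.
  apply/le_anti; rewrite sumr_ge0 // andbT.
  by rewrite sumrB -mulr_suml -mulr_sumr -/(mxtrace P) -mulrBl pmulr_lle0 // subr_le0.
have [j Pj] : exists j, 0 < P j j.
  apply: contrapT => N; suff : \tr P <= 0 by rewrite leNgt tr0.
  apply: sumr_le0 => j _; rewrite leNgt; apply/negP => h.
  by apply: N; exists j.
apply: H; exists j; split=> //.
by rewrite -subr_le0 S.
Qed.

End Projections.

(** * The walk *)

(* Discrete form of the fact that the solutions of [F' = q F (1 + c F)] have
   [F / (1 + c F)] proportional to [exp (q t)]. *)
Lemma logistic_step (R : realType) (c A q F F' : R) : 0 <= q -> 0 <= F ->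
  F <= A * (1 + c * F) -> 0 <= c -> 0 <= F' ->
  F' <= F * (1 + q * (1 + c * F)) -> F' <= A * (1 + q) * (1 + c * F').
Proof.
move=> q0 F0 FA c0 F'0 FF'.
have cF : 0 <= c * F by rewrite mulr_ge0.
have p : 0 < 1 + c * F by lra.
(* This is [F' / (1 + c F') <= (1 + q) F / (1 + c F)] with denominators cleared. *)
have s : F' * (1 - q * (c * F)) <= (1 + q) * F.
  have [h|h] := leP 0 (1 - q * (c * F)); last first.
    apply: (@le_trans _ _ 0); last by rewrite mulr_ge0 // addr_ge0.
    by rewrite mulr_ge0_le0 // ltW.
  apply: le_trans (ler_wpM2r h FF') _.
  rewrite -subr_ge0.
  have -> : (1 + q) * F - F * (1 + q * (1 + c * F)) * (1 - q * (c * F)) =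
    F * (q ^+ 2 * (c * F) * (1 + c * F)) by ring.
  apply: (mulr_ge0 F0); apply: (mulr_ge0 _ (ltW p)).
  by apply: (mulr_ge0 _ cF); apply: sqr_ge0.
rewrite -(ler_pM2r p).
apply: (@le_trans _ _ ((1 + q) * F * (1 + c * F'))).
  move: s; rewrite -subr_ge0 => s; rewrite -subr_ge0; apply: (le_trans s).
  by rewrite le_eqVlt; apply/orP; left; apply/eqP; ring.
have -> : A * (1 + q) * (1 + c * F') * (1 + c * F) =
  (1 + q) * (A * (1 + c * F)) * (1 + c * F') by ring.
by rewrite ler_wpM2r ?ler_wpM2l ?addr_ge0 ?mulr_ge0.
Qed.

Section Walk.
Variables (R : realType) (m n : nat) (V : 'M[R]_(m, n)) (eta theta : R).
Implicit Types (x y : 'rV[R]_n) (w : 'I_m -> R).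

Definition reweight (z : R) : R :=
  1 + eta * z + (eta * z) ^+ 2 / 2 * (1 + eta).

Definition walk_step x w x' w' : Prop :=
  exists y : 'rV[R]_n,
    [/\ dotp y y = 1, dotp x y = 0,
        \sum_i w i * dotp (row i V) y = 0,
        forall i, theta < w i -> dotp (row i V) y = 0
      & (\sum_i w i * dotp (row i V) y ^+ 2)
          * (n%:R - 2 - (\sum_i w i) / theta) <= \sum_i w i] /\
    (x' = x + (n%:R ^+ 2)^-1 *: y /\
     forall i, w' i = w i * reweight (dotp (row i V) y)).

(** Relative growth of the total weight per step, apart from the effect of freezing; [1 + 4 / n]
    pays for the two dimensions lost to [x] and the weighted sum. *)
Definition growth : R :=
  eta ^+ 2 / 2 * (1 + eta) / n%:R * (1 + 4 / n%:R).

(** [c * F] is twice the share of the [n] dimensions that [F / theta] frozen vectors can take up. *)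
Let c : R := 2 / (theta * n%:R).

Definition walk_inv (t : nat) x w : Prop :=
  [/\ dotp x x = t%:R / n%:R ^+ 4,
      forall i, 0 < w i <= 3 * theta,
      forall i, expR (eta * n%:R ^+ 2 * dotp (row i V) x) <= w i
    & \sum_i w i <= m%:R * (1 + growth) ^+ t * (1 + c * \sum_i w i)].

Hypothesis n8 : (8 <= n)%N.
Hypothesis V1 : forall i, dotp (row i V) (row i V) = 1.
Hypotheses (eta0 : 0 < eta) (eta1 : eta <= 1) (theta1 : 1 <= theta).
Hypothesis theta_large :
  8 * (m%:R * expR (growth * n%:R ^+ 4)) <= theta * n%:R.

Let n0 : 0 < n%:R :> R. Proof. by rewrite ltr0n (leq_trans _ n8). Qed.
Let n8R : 8 <= n%:R :> R. Proof. by rewrite (ler_nat R 8). Qed.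
Let theta0 : 0 < theta. Proof. by rewrite (lt_le_trans ltr01). Qed.
Let c0 : 0 < c. Proof. by rewrite divr_gt0 // mulr_gt0. Qed.

Lemma growth_ge0 : 0 <= growth.
Proof.
rewrite !mulr_ge0 ?sqr_ge0 ?invr_ge0 ?addr_ge0 //; try exact: ltW.
by rewrite mulr_ge0 ?invr_ge0 // ltW.
Qed.

Lemma walk_inv0 x w : x = 0 -> (forall i, w i = 1) -> walk_inv 0 x w.
Proof.
move=> -> w1; split.
- by rewrite mul0r; apply: big1 => j _; rewrite mxE mul0r.
- move=> i; rewrite w1 ltr01 /=; move: theta1; lra.
- move=> i; rewrite w1 (_ : dotp _ _ = 0) ?mulr0 ?expR0 //.
  by apply: big1 => j _; rewrite !mxE mulr0.
- under eq_bigr do rewrite w1.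
  rewrite sumr_const card_ord expr0 mulr1 ler_peMr // lerDl.
  by rewrite mulr_ge0 // ltW.
Qed.

(** The size of [theta] turns the logistic bound into [c F <= (1 + c F) / 4], hence [c F <= 1/3],
    that is [F / theta <= n / 6]. *)
Lemma walk_inv_frozen t x w : (t <= n ^ 4)%N -> walk_inv t x w ->
  c * \sum_i w i <= 3^-1.
Proof.
move=> tT [_ w0 _]; set F := \sum_i w i => H.
have F0 : 0 <= F by apply: sumr_ge0 => i _; case/andP: (w0 i) => /ltW.
have : (1 + growth) ^+ t <= expR (growth * n%:R ^+ 4).
  apply: (@le_trans _ _ ((expR growth) ^+ t)).
    by rewrite lerXn2r ?nnegrE ?expR_ge0 ?expR_ge1Dx ?addr_ge0 ?growth_ge0.
  rewrite -expRM_natr ler_expR ler_wpM2l ?growth_ge0 //.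
  by rewrite -natrX ler_nat.
move=> E; have cF0 : 0 <= c * F by rewrite mulr_ge0 // ltW.
have := le_trans (ler_wpM2l (ltW c0) H) _.
set G := m%:R * _ in H *.
have GB : c * G <= 4^-1.
  rewrite /c mulrAC ler_pdivrMr ?mulr_gt0 //.
  have : m%:R * (1 + growth) ^+ t <= m%:R * expR (growth * n%:R ^+ 4).
    by rewrite ler_wpM2l.
  by rewrite -/G; move: theta_large; lra.
move=> /(_ (4^-1 * (1 + c * F))) h.
have : c * F <= 4^-1 * (1 + c * F).
  by apply: h; rewrite mulrA ler_wpM2r // addr_ge0.
by lra.
Qed.

Lemma walk_inv_step t x w x' w' : (t < n ^ 4)%N ->
  walk_inv t x w -> walk_step x w x' w' -> walk_inv t.+1 x' w'.
Proof.
move=> tT I; have cF := walk_inv_frozen (ltnW tT) I.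
case: I => xx w0 we wF [y [[yy xy wy fy Qy] [-> w'E]]].
have z1 i : `|eta * dotp (row i V) y| <= eta.
  by rewrite normrM (ger0_norm (ltW eta0)) ler_piMr ?(ltW eta0) // CauchySchwarz_unit.
have f_ge i : expR (eta * dotp (row i V) y) <= reweight (dotp (row i V) y).
  exact: expR_le_quad.
(* A weight is multiplied by at most 3, so it overshoots [theta] at most by that factor before it is
   frozen. *)
have f_le i : reweight (dotp (row i V) y) <= 3.
  have := z1 i; rewrite /reweight; set a := eta * _ => a1.
  have a2 : `|a| <= 1 by apply: le_trans eta1.
  have a3 : a ^+ 2 <= 1 by rewrite -real_normK ?num_real // expr_le1.
  have := le_trans (ler_norm a) a2.
  have : a ^+ 2 / 2 * (1 + eta) <= 2^-1 * 2.
    apply: ler_pM => //; rewrite ?divr_ge0 ?sqr_ge0 ?addr_ge0 ?(ltW eta0) //.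
      lra.
    by move: eta1; lra.
  by lra.
have wi0 i : 0 <= w i by case/andP: (w0 i) => /ltW.
split.
- rewrite dotpDD !dotpZr xy dotpC dotpZr yy xx mulr0 mulr0 addr0 mulr1.
  by rewrite -natr1; field; rewrite gt_eqF.
- move=> i; rewrite w'E; case/andP: (w0 i) => wp wl.
  rewrite mulr_gt0 //=; last by apply: lt_le_trans (f_ge i); exact: expR_gt0.
  have [wt|wt] := leP (w i) theta; last first.
    by rewrite fy // /reweight mulr0 expr0n /= !mul0r !addr0 mulr1.
  rewrite mulrC; apply: ler_pM => //.
  by apply: le_trans (f_ge i); exact: expR_ge0.
- move=> i; rewrite w'E dotpDr dotpZr mulrDr expRD ler_pM ?expR_ge0 //.
  apply: le_trans (f_ge i); rewrite ler_expR le_eqVlt; apply/orP; left; apply/eqP.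
  by field; rewrite gt_eqF.
set F := \sum_i w i in wF Qy cF.
have F0 : 0 <= F by apply: sumr_ge0 => i _.
pose Q := \sum_i w i * dotp (row i V) y ^+ 2.
(* The linear term vanishes because [y] is orthogonal to the weighted sum of the vectors. *)
have F'E : \sum_i w' i = F + eta ^+ 2 / 2 * (1 + eta) * Q.
  transitivity (F + eta * \sum_i w i * dotp (row i V) y
      + eta ^+ 2 / 2 * (1 + eta) * Q); last by rewrite wy mulr0 addr0.
  rewrite !mulr_sumr -!big_split /=; apply: eq_bigr => i _.
  by rewrite w'E /reweight; ring.
rewrite exprSr mulrA; apply: logistic_step wF _ _ _; rewrite ?growth_ge0 ?(ltW c0) //.
  apply: sumr_ge0 => i _; rewrite w'E mulr_ge0 //.
  by apply: le_trans (f_ge i); exact: expR_ge0.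
rewrite F'E [F * _]mulrDr mulr1 lerD2l /growth.
have kE : F / theta = c * F * n%:R / 2.
  by rewrite /c; field; rewrite !gt_eqF.
move: cF Qy; rewrite kE -/Q; set k := c * F => k3 Qy.
have k0 : 0 <= k by rewrite mulr_ge0 // ltW.
set d := _ - _ in Qy.
have kn0 : 0 <= k * n%:R by rewrite mulr_ge0 // ltW.
have kn : k * n%:R <= 3^-1 * n%:R by rewrite ler_pM2r.
have d0 : 0 < d by rewrite /d; move: n8R; lra.
(* Here [d = n - 2 - k n / 2]; [n / d] is split into a factor for the two fixed constraints and the
   logistic factor [1 + k], using [8 <= n] and [k <= 1/3]. *)
have nd : n%:R <= d * ((1 + 4 / n%:R) * (1 + k)).
  apply: (@le_trans _ _ (d * (1 + 4 / n%:R + k))).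
    have -> : d * (1 + 4 / n%:R + k) =
      n%:R + (k * n%:R / 2 + 2) * (1 - 4 / n%:R - k).
      by rewrite /d; field; rewrite gt_eqF.
    have n4 : 4 / n%:R <= 2^-1 :> R by rewrite ler_pdivrMr //; move: n8R; lra.
    by rewrite lerDl mulr_ge0 //; lra.
  rewrite ler_wpM2l ?(ltW d0) // -subr_ge0.
  rewrite (_ : _ - _ = 4 / n%:R * k); last by ring.
  by rewrite mulr_ge0 // divr_ge0 // ltW.
have QF : Q <= F / n%:R * ((1 + 4 / n%:R) * (1 + k)).
  rewrite -(ler_pM2r d0) (le_trans Qy) //.
  rewrite (_ : _ * d = F * (d * ((1 + 4 / n%:R) * (1 + k)) / n%:R)); last by ring.
  by rewrite ler_peMr // ler_pdivlMr // mul1r.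
have e0 : 0 <= eta ^+ 2 / 2 * (1 + eta).
  by rewrite !mulr_ge0 ?sqr_ge0 ?invr_ge0 ?addr_ge0 // ltW.
have := ler_wpM2l e0 QF.
by congr (_ <= _); ring.
Qed.

End Walk.

(** * Choice of constants and the final bound *)

Section Budget.
Variables (R : realType) (m n : nat).
Hypotheses (n0 : (0 < n)%N) (nm : (16 * n <= m)%N).

Definition harmonic_gap : R := \sum_(n <= j < m) j%:R^-1.
(** Chosen so that [eta ^ 2 / 2 / n], summed over [n ^ 4] steps, is the harmonic sum [H], while
    [eta * n ^ 2 = sqrt (2 H n)]. *)
Definition step_size : R := Num.sqrt (2 * harmonic_gap / n%:R ^+ 3).
(** 64000 exceeds [8 * 3 ^ 8], which is what [growth_budget] consumes. *)
Definition freeze_factor : R := 40 * 40 * 40.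
Definition freeze_threshold : R := freeze_factor * (m%:R / n%:R) ^+ 2.
(** The logarithm is the excess of the walk, the 4 covers dimensions below 8, and [ln 2] converts to
    the base of [log2]. *)
Definition error_constant : R := (ln (3 * freeze_factor) / 2 + 4) / ln 2.

Local Notation H := harmonic_gap.
Local Notation L := (ln (m%:R / n%:R) : R).
Local Notation bound :=
  (Num.sqrt (2 * L / n%:R) * (1 + error_constant / log2 (m%:R / n%:R))).

Let nR0 : 0 < n%:R :> R. Proof. by rewrite ltr0n. Qed.
Let nm' : (n <= m)%N. Proof. lia. Qed.
Let r16 : 16 <= m%:R / n%:R :> R.
Proof. by rewrite ler_pdivlMr // -natrM ler_nat. Qed.
Let r0 : 0 < m%:R / n%:R :> R. Proof. by rewrite (lt_le_trans _ r16). Qed.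

Let L1 : 1 <= L.
Proof.
rewrite -[X in X <= _]expRK ler_ln ?posrE ?expR_gt0 //.
by apply: le_trans r16; have := expR1_le3 R; lra.
Qed.

Let L0 : 0 < L. Proof. exact: lt_le_trans L1. Qed.

Let ln2_gt0 : 0 < ln 2 :> R. Proof. by rewrite ln_gt0 // ltr1n. Qed.

Let fK1 : 1 <= 3 * freeze_factor. Proof. by rewrite /freeze_factor; lra. Qed.

Lemma error_constant_gt0 : 0 < error_constant.
Proof. by rewrite divr_gt0 // ltr_wpDl // divr_ge0 // ln_ge0. Qed.

Let boundE :
  bound = Num.sqrt (2 * L / n%:R) * (1 + (ln (3 * freeze_factor) / 2 + 4) / L).
Proof.
rewrite /log2 /error_constant; congr (_ * (1 + _)).
by field; rewrite !gt_eqF //; move: L1; lra.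
Qed.

Let err_ge0 : 0 <= (ln (3 * freeze_factor) / 2 + 4) / L.
Proof. by rewrite divr_ge0 ?(ltW L0) ?addr_ge0 ?divr_ge0 ?ln_ge0. Qed.

(** The regime where any unit vector will do. For [n <= 2 L] the square root is at least 1;
    otherwise [n < 8] and [L <= 4], and the term [4 / L] gives [sqrt (32 / (n L)) >= 1]. *)
Lemma bound_ge1 : (n < 8)%N || (n%:R <= 2 * L) -> 1 <= bound.
Proof.
move=> small; rewrite boundE; have [nL|nL] := leP n%:R (2 * L).
  rewrite -[X in X <= _]mulr1; apply: ler_pM => //; last by rewrite lerDl.
  by rewrite -[X in X <= _]sqrtr1 ler_wsqrtr // ler_pdivlMr // mul1r.
have {small} n8 : (n < 8)%N by move: small; rewrite leNgt nL orbF.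
apply: (@le_trans _ _ (Num.sqrt (2 * L / n%:R) * (4 / L))); last first.
  rewrite ler_wpM2l ?sqrtr_ge0 // [(_ / 2 + 4) / _]mulrDl addrA lerDr addr_ge0 //.
  by rewrite !mulr_ge0 ?invr_ge0 ?(ltW L0) ?ln_ge0.
have -> : 4 / L = Num.sqrt (16 / L ^+ 2).
  rewrite -[LHS]ger0_norm ?divr_ge0 ?(ltW L0) // -sqrtr_sqr; congr Num.sqrt.
  by field; rewrite gt_eqF.
rewrite -sqrtrM ?divr_ge0 ?mulr_ge0 ?(ltW L0) ?(ltW nR0) //.
rewrite -[X in X <= _]sqrtr1 ler_wsqrtr //.
rewrite (_ : 2 * L / n%:R * (16 / L ^+ 2) = 32 / (n%:R * L)); last first.
  by field; rewrite !gt_eqF.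
rewrite ler_pdivlMr ?mulr_gt0 // mul1r.
have n8R : n%:R <= 8 :> R by rewrite (ler_nat _ n 8) ltnW.
have : n%:R * L <= 8 * 4 by rewrite ler_pM ?(ltW nR0) ?(ltW L0) //; lra.
by lra.
Qed.

Let HL : L <= H <= L + n%:R^-1.
Proof.
have /andP[-> h] := harmonic_ln_bounds R n0 nm'; apply: (le_trans h).
by rewrite gerBl invr_ge0.
Qed.

Let H1 : 1 <= H. Proof. by case/andP: HL => h _; apply: le_trans h. Qed.

(** Logarithms are taken in [expR (sqrt (2 H n) <v_i, x>) <= w_i <= 3 theta]. *)
Lemma walk_inv_bound (V : 'M[R]_(m, n)) (x : 'rV[R]_n) (w : 'I_m -> R) :
  walk_inv V step_size freeze_threshold (n ^ 4) x w ->
  forall i, dotp (row i V) x <= bound.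
Proof.
case=> _ w0 we _ i; rewrite boundE.
have H0 : 0 < H by apply: lt_le_trans H1.
have mu : step_size * n%:R ^+ 2 = Num.sqrt (2 * H * n%:R).
  have -> : n%:R ^+ 2 = Num.sqrt ((n%:R ^+ 2) ^+ 2) :> R.
    by rewrite sqrtr_sqr ger0_norm // exprn_ge0 // ltW.
  rewrite -sqrtrM; last by rewrite divr_ge0 ?mulr_ge0 ?exprn_ge0 // ltW.
  by congr Num.sqrt; field; rewrite gt_eqF.
have e : Num.sqrt (2 * H * n%:R) * dotp (row i V) x
    <= 2 * L + ln (3 * freeze_factor).
  rewrite -mu -[X in X <= _]expRK.
  have /andP[_ wi] := w0 i; have := le_trans (we i) wi.
  rewrite -ler_ln ?posrE ?expR_gt0 //; last first.
    rewrite mulrA; apply: mulr_gt0; last exact: exprn_gt0.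
    exact: lt_le_trans fK1.
  move/le_trans; apply; rewrite /freeze_threshold mulrA.
  rewrite lnM ?posrE ?exprn_gt0 //; last by apply: lt_le_trans fK1.
  by rewrite lnXn // addrC [2 * L]mulr_natl.
have s0 : 0 < Num.sqrt (2 * H * n%:R) by rewrite sqrtr_gt0 !mulr_gt0.
have B0 : 0 <= 2 * L + ln (3 * freeze_factor).
  by apply: addr_ge0; [apply: mulr_ge0 (ltW L0) | apply: ln_ge0].
move: e; rewrite mulrC -ler_pdivlMr // => /le_trans; apply.
(* Replacing [H] by the smaller [L] only enlarges the quotient, its numerator being nonnegative. *)
apply: (@le_trans _ _ ((2 * L + ln (3 * freeze_factor)) / Num.sqrt (2 * L * n%:R))).
  rewrite ler_wpM2l // lef_pV2 ?posrE ?sqrtr_gt0 ?mulr_gt0 //.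
  rewrite ler_wsqrtr // ler_pM2r // ler_pM2l //.
  by case/andP: HL.
rewrite ler_pdivrMr ?sqrtr_gt0 ?mulr_gt0 //.
rewrite mulrAC -sqrtrM ?divr_ge0 ?mulr_ge0 ?(ltW nR0) ?(ltW L0) //.
rewrite (_ : 2 * L / n%:R * (2 * L * n%:R) = (2 * L) ^+ 2); last first.
  by field; rewrite gt_eqF.
rewrite sqrtr_sqr ger0_norm ?mulr_ge0 ?(ltW L0) //.
rewrite (_ : _ * (1 + _) = 2 * L + ln (3 * freeze_factor) + 8); last first.
  by field; rewrite gt_eqF.
by rewrite lerDl.
Qed.

Hypotheses (n8 : (8 <= n)%N) (Ln : 2 * L < n%:R).

Let n8R : 8 <= n%:R :> R. Proof. by rewrite (ler_nat R 8). Qed.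

Let H34 : H <= 3 / 4 * n%:R.
Proof.
have /andP[_ h] := HL; apply: (le_trans h).
have : n%:R^-1 <= 1 :> R by rewrite invf_le1 //; move: n8R; lra.
by move: n8R Ln; lra.
Qed.

Let step_sizeE : step_size ^+ 2 = 2 * H / n%:R ^+ 3.
Proof.
rewrite sqr_sqrtr // !mulr_ge0 ?invr_ge0 ?exprn_ge0 ?(ltW nR0) //.
exact: le_trans H1.
Qed.

(** The square is [2 (H / n) ^ 3 <= 2 (3/4) ^ 3 < 1]. Hence the factor [1 + eta] adds only a
    constant to the growth exponent. *)
Let step_sizeH : step_size * H <= 1.
Proof.
have H0 : 0 <= H by rewrite (le_trans _ H1).
rewrite -(@ler_pXn2r _ 2) ?nnegrE ?mulr_ge0 ?sqrtr_ge0 // exprMn step_sizeE expr1n.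
rewrite mulrAC ler_pdivrMr ?exprn_gt0 // mul1r.
have : H ^+ 3 <= (3 / 4 * n%:R) ^+ 3.
  by rewrite lerXn2r ?nnegrE // mulr_ge0 ?divr_ge0 // ltW.
rewrite exprMn; have : 0 <= n%:R ^+ 3 :> R by rewrite exprn_ge0 // ltW.
rewrite (_ : 2 * H * H ^+ 2 = 2 * H ^+ 3); last by ring.
by move: (H ^+ 3) (n%:R ^+ 3) => a b; lra.
Qed.

Lemma step_size_gt0 : 0 < step_size.
Proof.
rewrite sqrtr_gt0 !mulr_gt0 ?invr_gt0 ?exprn_gt0 //; exact: lt_le_trans H1.
Qed.

Lemma step_size_le1 : step_size <= 1.
Proof.
apply: le_trans step_sizeH; rewrite ler_peMr //; exact: sqrtr_ge0.
Qed.

Lemma freeze_threshold_ge1 : 1 <= freeze_threshold.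
Proof.
rewrite -[X in X <= _]mulr1 ler_pM //; first by rewrite /freeze_factor; lra.
by rewrite exprn_ege1 // (le_trans _ r16) // (ler_nat R 1 16).
Qed.

(** The exponent [H (1 + eta) (1 + 4 / n)] exceeds [H] by at most [eta H <= 1] plus
    [(1 + eta) 4 H / n <= 6], so it is at most [L + 8]; and [expR 8 <= 3 ^ 8]. *)
Lemma growth_budget :
  8 * (m%:R * expR (growth n step_size * n%:R ^+ 4)) <= freeze_threshold * n%:R.
Proof.
have g : growth n step_size * n%:R ^+ 4 <= L + 8.
  have -> : growth n step_size * n%:R ^+ 4 =
      H * (1 + step_size) * (1 + 4 / n%:R).
    by rewrite /growth step_sizeE; field; rewrite gt_eqF.
  have n1 : n%:R^-1 <= 8^-1 :> R by rewrite lef_pV2 ?posrE.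
  have /andP[_ HL2] := HL.
  have Hn : H * (4 / n%:R) <= 3.
    rewrite mulrA ler_pdivrMr //; move: H34; lra.
  have -> : H * (1 + step_size) * (1 + 4 / n%:R) =
    H + step_size * H + (1 + step_size) * (H * (4 / n%:R)) by ring.
  have : (1 + step_size) * (H * (4 / n%:R)) <= 2 * 3.
    apply: ler_pM => //.
    - by rewrite addr_ge0 // ltW // step_size_gt0.
    - by rewrite mulr_ge0 ?divr_ge0 ?(ltW nR0) // (le_trans _ H1).
    - by have := step_size_le1; lra.
  by move: step_sizeH; lra.
have e8 : expR 8 <= (81 * 81) :> R.
  have -> : (8 : R) = 8%:R * 1 by rewrite mulr1.
  rewrite expRM_natl (le_trans (lerXn2r 8 _ _ (expR1_le3 R))) ?nnegrE ?expR_ge0 //.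
  by lra.
have eg : expR (growth n step_size * n%:R ^+ 4) <= m%:R / n%:R * (81 * 81).
  apply: (@le_trans _ _ (expR (L + 8))); first by rewrite ler_expR.
  by rewrite expRD lnK ?posrE // ler_wpM2l // ltW.
have a0 : 0 <= m%:R * (m%:R / n%:R) :> R by rewrite mulr_ge0 // ltW.
have := ler_wpM2l (ler0n R m) eg.
rewrite [_ * (_ * (81 * 81))]mulrA => h.
have -> : freeze_threshold * n%:R = freeze_factor * (m%:R * (m%:R / n%:R)).
  by rewrite /freeze_threshold; field; rewrite gt_eqF.
apply: le_trans (ler_wpM2l (ler0n R 8) h) _.
by rewrite mulrCA [leLHS]mulrC ler_wpM2r // /freeze_factor; lra.
Qed.

End Budget.

(** * The program *)

Fixpoint writes (p : lprog) : seq nat :=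
  match p with
  | LSkip => [::]
  | LSet a _ _ _ => [:: a]
  | LSeq p1 p2 | LIf _ p1 p2 => writes p1 ++ writes p2
  | LFor _ _ p1 => writes p1
  end.

Definition LSum (a : nat) (i j : nexp) (r b : nat) (e : rexp) : lprog :=
  LSeq (LSet a i j (RCast (NConst 0)))
    (LFor r b (LSet a i j (RAdd (RCell a i j) e))).

Section Loops.
Variable R : realType.
Implicit Types (g : nat -> nat) (M : memory R).

Definition fill_row M (a i n : nat) (v : nat -> R) : memory R :=
  fun a' i' j' => if [&& a' == a, i' == i & (j' < n)%N] then v j' else M a' i' j'.

Definition fill_mx M (a m n : nat) (v : nat -> nat -> R) : memory R :=
  fun a' i' j' =>
    if [&& a' == a, (i' < m)%N & (j' < n)%N] then v i' j' else M a' i' j'.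

Lemma den_frame p g M a : a \notin writes p -> den p g M a = M a.
Proof.
elim: p g M => //=.
- move=> b i j e g M; rewrite inE => ab; apply/funext => i'; apply/funext => j'.
  by rewrite /upd_mem (negbTE ab).
- by move=> p IHp q IHq g M; rewrite mem_cat negb_or => /andP[/IHp Hp /IHq ->].
- move=> b p IHp q IHq g M; rewrite mem_cat negb_or => /andP[/IHp Hp /IHq Hq].
  by case: ifP.
- move=> r b p IH g M ap; elim: (g b) => //= k IHk.
  by rewrite IH.
Qed.

Lemma den_LSet a i j e g M :
  den (LSet a i j e) g M =
  upd_mem M a (neval (Store g M) i) (neval (Store g M) j) (reval (Store g M) e).
Proof. by []. Qed.

Lemma den_LSkip g M : den LSkip g M = M.
Proof. by []. Qed.

Lemma den_LSeq p q g M : den (LSeq p q) g M = den q g (den p g M).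
Proof. by []. Qed.

Lemma den_LIf b p q g M :
  den (LIf b p q) g M = if beval (Store g M) b then den p g M else den q g M.
Proof. by []. Qed.

Lemma den_LFor_ind (I : nat -> memory R -> Prop) r b p g M :
  I 0%N M ->
  (forall k M', (k < g b)%N -> I k M' -> I k.+1 (den p (upd_env g r k) M')) ->
  I (g b) (den (LFor r b p) g M).
Proof.
move=> I0 IS /=.
suff: forall k, (k <= g b)%N ->
    I k (iteri k (fun l M' => den p (upd_env g r l) M') M) by apply.
elim=> [|k IHk] kn //=; apply: IS => //; apply: IHk; exact: ltnW.
Qed.

(** The summand is evaluated with the partial sum already in its cell; quantifying over that value
    [x] says that the summand does not depend on it. *)
Lemma den_LSum a i j r b e n g M (v : nat -> R) I J :
  g b = n ->
  (forall M', neval (Store g M') i = I) -> (forall M', neval (Store g M') j = J) ->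
  (forall k M', neval (Store (upd_env g r k) M') i = I) ->
  (forall k M', neval (Store (upd_env g r k) M') j = J) ->
  (forall k x, (k < n)%N ->
    reval (Store (upd_env g r k) (upd_mem M a I J x)) e = v k) ->
  den (LSum a i j r b e) g M = upd_mem M a I J (\sum_(k < n) v k).
Proof.
move=> <- i0 j0 iI jJ ev; rewrite den_LSeq.
apply: (@den_LFor_ind (fun k M' => M' = upd_mem M a I J (\sum_(l < k) v l))).
  by rewrite big_ord0 /= i0 j0.
move=> k M' kn -> /=; rewrite iI jJ ev // big_ord_recr /=.
apply/funext => a'; apply/funext => i'; apply/funext => j'; rewrite /upd_mem.
by rewrite !eqxx; case: (_ && _).
Qed.

(** The body is run only where the first [k] entries are new and entry [k] is still old, which
    covers updates in place. *)
Lemma den_fill_row a i r b p n g M (v : nat -> R) :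
  g b = n ->
  (forall k, (k < n)%N -> den p (upd_env g r k) (fill_row M a i k v) =
     upd_mem (fill_row M a i k v) a i k (v k)) ->
  den (LFor r b p) g M = fill_row M a i n v.
Proof.
move=> <- H; apply: (@den_LFor_ind (fun k M' => M' = fill_row M a i k v)).
  apply/funext => a'; apply/funext => i'; apply/funext => j'.
  by rewrite /fill_row ltn0 !andbF.
move=> k M' kn ->; rewrite H //.
apply/funext => a'; apply/funext => i'; apply/funext => j'.
rewrite /fill_row /upd_mem [(j' < k.+1)%N]ltnS [(j' <= k)%N]leq_eqVlt.
case: (a' == a) => //=; case: (i' == i) => //=.
by case: eqP => [->|_].
Qed.

Lemma den_fill_mx a r b p m n g M (v : nat -> nat -> R) :
  g b = m ->
  (forall k, (k < m)%N -> den p (upd_env g r k) (fill_mx M a k n v) =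
     fill_row (fill_mx M a k n v) a k n (v k)) ->
  den (LFor r b p) g M = fill_mx M a m n v.
Proof.
move=> <- H; apply: (@den_LFor_ind (fun k M' => M' = fill_mx M a k n v)).
  apply/funext => a'; apply/funext => i'; apply/funext => j'.
  by rewrite /fill_mx ltn0 !andbF.
move=> k M' kn ->; rewrite H //.
apply/funext => a'; apply/funext => i'; apply/funext => j'.
rewrite /fill_mx /fill_row [(i' < k.+1)%N]ltnS [(i' <= k)%N]leq_eqVlt.
case: (a' == a) => //=; case: (j' < n)%N; rewrite ?andbF //= !andbT.
by case: eqP => [->|_].
Qed.

End Loops.

Arguments den : simpl never.

(* Register 0 holds [m] and register 1 holds [n]; all other registers are loop
   counters.  Arrays: 0 the input vectors, 1 the output, 2 the position [x],
   3 the weights, 4 the projection [P], 5 and 8 the projected constraint and its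
   squared norm, 6 the unit direction [y], 7 the gradient [sum_i w_i v_i],
   9 the harmonic sum, 10 the step size [eta], 11 the threshold [theta],
   12 the trace of [P], 13 the total weight, 14 inner products with the [v_i],
   15 the weighted second moment of a candidate direction, 16 [|x|^2]. *)
Definition RNum (k : nat) : rexp := RCast (NConst k).
Definition rscalar (a : nat) : rexp := RCell a (NConst 0) (NConst 0).
Definition entry (a r : nat) : rexp := RCell a (NConst 0) (NReg r).
Definition entry2 (a r r' : nat) : rexp := RCell a (NReg r) (NReg r').

(** [c] gives the coordinates of the constraint, indexed by register 8. The product [c P] and its
    squared norm are stored first, so [P] can be updated in place. *)
Definition project_prog (c : rexp) : lprog :=
  LSeq (LFor 7 1 (LSum 5 (NConst 0) (NReg 7) 8 1 (RMul c (entry2 4 8 7))))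
  (LSeq (LSum 8 (NConst 0) (NConst 0) 7 1 (RMul (entry 5 7) (entry 5 7)))
    (LIf (BRealLe (rscalar 8) (RNum 0)) LSkip
      (LFor 7 1 (LFor 8 1 (LSet 4 (NReg 7) (NReg 8)
        (RSub (entry2 4 7 8)
          (RDiv (RMul (entry 5 7) (entry 5 8)) (rscalar 8)))))))).

(** With truncated subtraction, [1 - (j - l) - (l - j)] is the Kronecker delta. *)
Definition identity_prog : lprog :=
  LFor 7 1 (LFor 8 1 (LSet 4 (NReg 7) (NReg 8)
    (RCast (NSub (NSub (NConst 1) (NSub (NReg 7) (NReg 8)))
      (NSub (NReg 8) (NReg 7)))))).

Definition gradient_prog : lprog :=
  LFor 8 1 (LSum 7 (NConst 0) (NReg 8) 6 0 (RMul (entry 3 6) (entry2 0 6 8))).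

Definition freeze_prog : lprog :=
  LFor 6 0 (LIf (BRealLe (entry 3 6) (rscalar 11)) LSkip
    (project_prog (entry2 0 6 8))).

Definition totals_prog : lprog :=
  LSeq (LSum 12 (NConst 0) (NConst 0) 7 1 (entry2 4 7 7))
    (LSum 13 (NConst 0) (NConst 0) 6 0 (entry 3 6)).

(** A counted loop has no early exit, so all rows are tried and the last acceptable one is kept,
    divided by its norm [sqrt (P j j)]. *)
Definition search_prog : lprog :=
  LFor 9 1
    (LSeq (LFor 6 0
      (LSum 14 (NConst 0) (NReg 6) 8 1 (RMul (entry2 0 6 8) (entry2 4 9 8))))
    (LSeq (LSum 15 (NConst 0) (NConst 0) 6 0
      (RMul (entry 3 6) (RMul (entry 14 6) (entry 14 6))))
    (LIf (BAnd (BNot (BRealLe (entry2 4 9 9) (RNum 0)))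
           (BRealLe (RMul (rscalar 15) (rscalar 12))
              (RMul (rscalar 13) (entry2 4 9 9))))
      (LFor 8 1 (LSet 6 (NConst 0) (NReg 8)
         (RDiv (entry2 4 9 8) (RSqrt (entry2 4 9 9)))))
      LSkip))).

Definition move_prog : lprog :=
  LFor 8 1 (LSet 2 (NConst 0) (NReg 8)
    (RAdd (entry 2 8)
       (RDiv (entry 6 8) (RMul (RCast (NReg 1)) (RCast (NReg 1)))))).

Definition reweight_prog : lprog :=
  let a := RMul (rscalar 10) (entry 14 6) in
  LSeq (LFor 6 0
    (LSum 14 (NConst 0) (NReg 6) 8 1 (RMul (entry2 0 6 8) (entry 6 8))))
  (LFor 6 0 (LSet 3 (NConst 0) (NReg 6)
    (RMul (entry 3 6)
      (RAdd (RAdd (RNum 1) a)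
        (RMul (RDiv (RMul a a) (RNum 2)) (RAdd (RNum 1) (rscalar 10))))))).

Definition step_prog : lprog :=
  LSeq identity_prog
  (LSeq (project_prog (entry 2 8))
  (LSeq gradient_prog
  (LSeq (project_prog (entry 7 8))
  (LSeq freeze_prog
  (LSeq totals_prog
  (LSeq search_prog
  (LSeq move_prog reweight_prog))))))).

(** Loops start at 0, so the harmonic sum is cut to [n <= j] by the truncated numerator
    [1 - (n - j)], which is 1 there and 0 below. *)
Definition setup_prog : lprog :=
  LSeq (LFor 6 0 (LSet 3 (NConst 0) (NReg 6) (RNum 1)))
  (LSeq (LSum 9 (NConst 0) (NConst 0) 6 0
     (RDiv (RCast (NSub (NConst 1) (NSub (NReg 1) (NReg 6)))) (RCast (NReg 6))))
  (LSeq (LSet 10 (NConst 0) (NConst 0)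
     (RSqrt (RDiv (RMul (RNum 2) (rscalar 9))
        (RMul (RCast (NReg 1)) (RMul (RCast (NReg 1)) (RCast (NReg 1)))))))
  (LSet 11 (NConst 0) (NConst 0)
     (RMul (RMul (RMul (RNum 40) (RNum 40)) (RNum 40))
        (RMul (RDiv (RCast (NReg 0)) (RCast (NReg 1)))
              (RDiv (RCast (NReg 0)) (RCast (NReg 1)))))))).

(** Outside the regime of the walk nothing is known about [x], so it is normalised, or replaced by a
    coordinate vector if it is zero. *)
Definition output_prog : lprog :=
  LSeq (LSum 16 (NConst 0) (NConst 0) 8 1 (RMul (entry 2 8) (entry 2 8)))
    (LIf (BRealLe (rscalar 16) (RNum 0))
      (LSet 1 (NConst 0) (NConst 0) (RNum 1))
      (LFor 8 1 (LSet 1 (NConst 0) (NReg 8)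
         (RDiv (entry 2 8) (RSqrt (rscalar 16)))))).

(** Loop bounds can only be [m] or [n], hence four nested loops for [n ^ 4] steps. *)
Definition walk_prog : lprog :=
  LFor 2 1 (LFor 3 1 (LFor 4 1 (LFor 5 1 step_prog))).

Definition main_prog : lprog := LSeq setup_prog (LSeq walk_prog output_prog).

(** * Correctness of the projection blocks *)

Section Specifications.
Variables (R : realType) (m n : nat) (V : 'M[R]_(m, n)).
Implicit Types (g : nat -> nat) (M : memory R).

Definition mx_of M a : 'M[R]_n := \matrix_(i, j) M a i j.
Definition rv_of M a : 'rV[R]_n := \row_j M a 0%N j.
Definition weights M : 'I_m -> R := fun i => M 3%N 0%N i.
Definition holds_input M := forall (i : 'I_m) (j : 'I_n), M 0%N i j = V i j.

Lemma mx_of_fill_mx M a v :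
  mx_of (fill_mx M a n n v) a = \matrix_(i, j) v i j.
Proof. by apply/matrixP => i j; rewrite !mxE /fill_mx eqxx !ltn_ord. Qed.

Lemma rv_of_fill_row M a v : rv_of (fill_row M a 0 n v) a = \row_j v j.
Proof. by apply/rowP => j; rewrite !mxE /fill_row !eqxx ltn_ord. Qed.

Variable g : nat -> nat.
Hypotheses (g0 : g 0%N = m) (g1 : g 1%N = n).

Lemma identity_progP M : mx_of (den identity_prog g M) 4 = 1%:M.
Proof.
rewrite (@den_fill_mx _ 4%N _ _ _ n n _ _
  (fun j l => (1 - (j - l) - (l - j))%N%:R)) //; last first.
  by move=> k _; exact: den_fill_row.
rewrite mx_of_fill_mx; apply/matrixP => i j; rewrite !mxE.
congr _%:R; rewrite -val_eqE /=; lia.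
Qed.

(** The value of [c] must not depend on array 5, which is being filled while [c] is evaluated. *)
Lemma project_progP M c (cv : nat -> R) :
  (forall j k M', (k < n)%N -> (forall a, a != 5%N -> M' a = M a) ->
     reval (Store (upd_env (upd_env g 7 j) 8 k) M') c = cv k) ->
  mx_of (den (project_prog c) g M) 4 = project_out (mx_of M 4) (\row_k cv k).
Proof.
move=> cE; rewrite /project_prog den_LSeq den_LSeq.
pose u j := \sum_(k < n) cv k * M 4%N k j.
rewrite (@den_fill_row _ 5%N 0%N _ _ _ n _ _ u) //; last first.
  move=> k kn; apply: (@den_LSum _ _ _ _ _ _ _ n _ _
    (fun l => cv l * M 4%N l k) 0%N k) => // l x ln /=.
  rewrite cE // => a a5.
  apply/funext => i; apply/funext => j.
  by rewrite /upd_mem /fill_row (negbTE a5).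
rewrite (@den_LSum _ _ _ _ _ _ _ n _ _ (fun k => u k * u k) 0%N 0%N) //; last first.
  by move=> k x kn /=; rewrite /upd_mem /fill_row /upd_env /= kn.
set M1 := upd_mem _ _ _ _ _.
have uE : (\row_k cv k) *m mx_of M 4 = \row_k u k.
  by apply/rowP => j; rewrite !mxE; apply: eq_bigr => k _; rewrite !mxE.
have NE : dotp (\row_k u k) (\row_(k < n) u k) = \sum_(k < n) u k * u k.
  by apply: eq_bigr => k _; rewrite !mxE.
have M1_8 : M1 8%N 0%N 0%N = \sum_(k < n) u k * u k by rewrite /M1 /upd_mem.
have M1_4 i j : M1 4%N i j = M 4%N i j by rewrite /M1 /upd_mem /fill_row.
have M1_5 j : (j < n)%N -> M1 5%N 0%N j = u j.
  by move=> jn; rewrite /M1 /upd_mem /fill_row /= jn.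
rewrite /project_out uE NE den_LIf [beval _ _]/= M1_8; case: ifP => N0.
  by apply/matrixP => i j; rewrite den_LSkip !mxE M1_4.
set N := \sum_(k < n) _ in M1_8 *.
rewrite (@den_fill_mx _ 4%N _ _ _ n n _ _ (fun j l => M 4%N j l - u j * u l / N)) //.
  rewrite mx_of_fill_mx; apply/matrixP => i j; rewrite !mxE.
  by rewrite big_ord1 !mxE mulrC.
move=> j jn; apply: den_fill_row => // l ln.
rewrite den_LSet /= /upd_env /=; congr upd_mem; rewrite {1}/fill_row ltnn !andbF.
rewrite /fill_row /fill_mx /= ltnn /= M1_4 M1_8 !M1_5 //.
Qed.

End Specifications.

(** * Correctness of one step of the walk *)

Section Step.
Variables (R : realType) (m n : nat) (V : 'M[R]_(m, n)).
Implicit Types (M : memory R).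
Variable g : nat -> nat.
Hypotheses (g0 : g 0%N = m) (g1 : g 1%N = n).

Local Notation mx := (@mx_of R n).
Local Notation rv := (@rv_of R n).
Local Notation wt := (@weights R m).

Lemma gradient_progP M : holds_input V M ->
  rv (den gradient_prog g M) 7 = \sum_i wt M i *: row i V.
Proof.
move=> MV.
rewrite (@den_fill_row _ 7%N 0%N _ _ _ n _ _
  (fun l => \sum_(k < m) M 3%N 0%N k * M 0%N k l)) //; last first.
  move=> l ln; apply: (@den_LSum _ _ _ _ _ _ _ m _ _
    (fun k => M 3%N 0%N k * M 0%N k l) 0%N l) => // k x km.
rewrite rv_of_fill_row; apply/rowP => l; rewrite summxE mxE.
by apply: eq_bigr => i _; rewrite !mxE MV.
Qed.

(** Each frozen vector lowers the trace by at most 1, and its weight divided by the threshold is at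
    least 1, so the total loss is at most [F / theta]. *)
Lemma freeze_progP M : holds_input V M ->
  is_proj (mx M 4) -> (forall i, 0 < wt M i) -> 0 < M 11%N 0%N 0%N ->
  let P := mx (den freeze_prog g M) 4 in
  [/\ is_proj P, forall c : 'rV_n, c *m mx M 4 = 0 -> c *m P = 0,
      forall i, M 11%N 0%N 0%N < wt M i -> row i V *m P = 0
    & \tr (mx M 4) - (\sum_i wt M i) / M 11%N 0%N 0%N <= \tr P].
Proof.
move=> MV projP w0 th0 /=; set th := M 11%N 0%N 0%N.
pose I k M' := (k <= m)%N ->
  [/\ forall a, a \notin writes freeze_prog -> M' a = M a,
      is_proj (mx M' 4), forall c : 'rV_n, c *m mx M 4 = 0 -> c *m mx M' 4 = 0,
      forall i : 'I_m, (i < k)%N -> th < wt M i -> row i V *m mx M' 4 = 0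
    & \tr (mx M 4) - \sum_(i < m | (i < k)%N) wt M i / th <= \tr (mx M' 4)].
have : I (g 0%N) (den freeze_prog g M).
  apply: den_LFor_ind => [_|k M' _ IH km].
    split=> //.
    by rewrite big_pred0 ?subr0.
  have {IH} [fr pr ke fz tr] := IH (ltnW km).
  have kE (i : 'I_m) : (i < k.+1)%N = (i == Ordinal km) || (i < k)%N.
    by rewrite ltnS leq_eqVlt.
  have sumE : \sum_(i < m | (i < k.+1)%N) wt M i / th =
      wt M (Ordinal km) / th + \sum_(i < m | (i < k)%N) wt M i / th.
    rewrite (bigD1 (Ordinal km)) //=; congr (_ + _); apply: eq_bigl => i.
    by rewrite kE -val_eqE /=; lia.
  have bE : beval (Store (upd_env g 6 k) M')
      (BRealLe (entry 3 6) (rscalar 11)) = (wt M (Ordinal km) <= th).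
    by rewrite /= fr // fr.
  rewrite den_LIf bE sumE; case: ifPn => wth.
    split=> //.
      move=> i; rewrite kE => /orP[/eqP->|]; last exact: fz.
      by rewrite ltNge wth.
    apply: le_trans tr; rewrite lerD2l lerN2 lerDr.
    by rewrite divr_ge0 // ltW.
  set M2 := den _ _ _.
  have M2E : mx M2 4 = project_out (mx M' 4) (row (Ordinal km) V).
    rewrite /M2 (@project_progP _ _ (upd_env g 6 k) g1 _ _ (fun l => M 0%N k l)) //.
      congr project_out; apply/rowP => l; rewrite !mxE.
      exact: (MV (Ordinal km) l).
    by move=> j l M3 ln H /=; rewrite H // fr.
  rewrite M2E; split.
  - move=> a aw; rewrite /M2 den_frame ?fr //.
  - exact: project_out_is_proj.
  - by move=> c /ke; exact: mulmx_project_out_eq0.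
  - move=> i; rewrite kE => /orP[/eqP-> _|ik /fz h].
      exact: mulmx_project_out.
    by apply: mulmx_project_out_eq0 => //; exact: h.
  - have := @mxtrace_project_out _ _ (mx M' 4) (row (Ordinal km) V).
    rewrite -ltNge in wth.
    have : 1 <= wt M (Ordinal km) / th by rewrite ler_pdivlMr // mul1r ltW.
    by move: tr; lra.
rewrite g0 => /(_ (leqnn m)) [_ pr ke fz tr]; split=> //.
  by move=> i; apply: fz.
move: tr; rewrite mulr_suml.
by under eq_bigl do rewrite ltn_ord.
Qed.

Lemma totals_progP M :
  den totals_prog g M 12 0%N 0%N = \tr (mx M 4) /\
  den totals_prog g M 13 0%N 0%N = \sum_i wt M i.
Proof.
rewrite /totals_prog den_LSeq.
rewrite (@den_LSum _ 12%N _ _ _ _ _ n _ _ (fun k => M 4%N k k) 0%N 0%N) //.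
rewrite (@den_LSum _ 13%N _ _ _ _ _ m _ _ (fun k => M 3%N 0%N k) 0%N 0%N) //.
split; rewrite /upd_mem //=.
by rewrite /mxtrace; apply: eq_bigr => i _; rewrite mxE.
Qed.

Lemma search_progP M : holds_input V M ->
  let P := mx M 4 in
  let low j := 0 < P j j /\
    (\sum_i wt M i * dotp (row i V) (row j P) ^+ 2) * M 12%N 0%N 0%N
      <= M 13%N 0%N 0%N * P j j in
  (exists j, low j) ->
  exists j, low j /\
    rv (den search_prog g M) 6 = (Num.sqrt (P j j))^-1 *: row j P.
Proof.
move=> MV P low [j0 j0P].
(* Invariant: once one of the first [k] rows is acceptable, array 6 holds some normalised acceptable
   row. *)
pose I k M' := (k <= n)%N ->
  (forall a, a \notin writes search_prog -> M' a = M a) /\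
  ((exists j : 'I_n, (j < k)%N /\ low j) ->
   exists j, low j /\ rv M' 6 = (Num.sqrt (P j j))^-1 *: row j P).
have : I (g 1%N) (den search_prog g M); last first.
  by rewrite g1 => /(_ (leqnn n))[_]; apply; exists j0; rewrite ltn_ord.
apply: den_LFor_ind => [_|k M' _ IH kn].
  by split=> // -[j []].
have {IH} [fr IH] := IH (ltnW kn).
split.
  by move=> a aw; rewrite den_frame ?fr.
set gk := upd_env g 9 k.
pose ko := Ordinal kn.
pose z i := \sum_(l < n) M 0%N i l * M 4%N k l.
rewrite den_LSeq (@den_fill_row _ 14%N 0%N _ _ _ m gk _ z) //; last first.
  move=> i im; apply: (@den_LSum _ _ _ _ _ _ _ n _ _
    (fun l => M 0%N i l * M 4%N k l) 0%N i) => // l x ln.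
  by rewrite /= /upd_mem /fill_row /gk /upd_env /= !fr.
rewrite den_LSeq (@den_LSum _ 15%N _ _ _ _ _ m _ _
  (fun i => M 3%N 0%N i * (z i * z i)) 0%N 0%N) //; last first.
  by move=> i x im; rewrite /= /upd_mem /fill_row /upd_env /= im !fr.
set M1 := upd_mem _ _ _ _ _.
have fr1 a : a \notin writes search_prog -> M1 a = M a.
  move=> aw; rewrite -(fr a aw); apply/funext => i; apply/funext => j.
  move: aw; rewrite /M1 /upd_mem /fill_row !inE !negb_or.
  by do !case: eqP.
have PkE : P ko ko = M 4%N k k by rewrite !mxE.
have QE : \sum_(i < m) M 3%N 0%N i * (z i * z i) =
    \sum_i wt M i * dotp (row i V) (row ko P) ^+ 2.
  apply: eq_bigr => i _; rewrite expr2 (_ : z i = dotp (row i V) (row ko P)) //.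
  by apply: eq_bigr => l _; rewrite !mxE MV.
rewrite den_LIf; set b := beval _ _.
have bE : b = (0 < P ko ko) &&
  ((\sum_i wt M i * dotp (row i V) (row ko P) ^+ 2) * M 12%N 0%N 0%N
      <= M 13%N 0%N 0%N * P ko ko).
  rewrite PkE /b /= -ltNge (fr1 4%N) // (fr1 12%N) // (fr1 13%N) // /gk /upd_env /=.
  by rewrite -QE.
case: ifPn => bP.
  move=> _; exists ko; split.
    by move: bP; rewrite bE => /andP.
  rewrite (@den_fill_row _ 6%N 0%N _ _ _ n _ _
    (fun l => M 4%N k l / Num.sqrt (M 4%N k k))) //.
    rewrite rv_of_fill_row; apply/rowP => l; rewrite !mxE.
    by rewrite mulrC.
  move=> l ln; rewrite den_LSet /=; congr upd_mem.
  by rewrite /fill_row /= !fr1.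
move=> [j [jk jl]]; have [|jk'] := ltnP j k; first last.
  have jE : j = ko by apply: val_inj => /=; lia.
  by move: bP; rewrite bE -jE; case: jl => -> ->.
move=> jk'; rewrite den_LSkip.
have [j1 [low1 e1]] : exists j, low j /\ rv M' 6 = (Num.sqrt (P j j))^-1 *: row j P.
  by apply: IH; exists j.
by exists j1.
Qed.

Lemma move_progP M :
  rv (den move_prog g M) 2 = rv M 2 + (n%:R ^+ 2)^-1 *: rv M 6.
Proof.
rewrite (@den_fill_row _ 2%N 0%N _ _ _ n _ _
  (fun l => M 2%N 0%N l + M 6%N 0%N l / (n%:R * n%:R))) //.
  rewrite rv_of_fill_row; apply/rowP => l; rewrite !mxE.
  by rewrite mulrC expr2.
move=> l ln; rewrite den_LSet /=; congr upd_mem.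
by rewrite /fill_row /upd_env /= ltnn g1.
Qed.

Lemma reweight_progP M : holds_input V M -> forall i,
  wt (den reweight_prog g M) i =
  wt M i * reweight (M 10%N 0%N 0%N) (dotp (row i V) (rv M 6)).
Proof.
move=> MV i.
pose z i := \sum_(l < n) M 0%N i l * M 6%N 0%N l.
rewrite /reweight_prog den_LSeq (@den_fill_row _ 14%N 0%N _ _ _ m g M z) //; last first.
  move=> k km; apply: (@den_LSum _ _ _ _ _ _ _ n _ _
    (fun l => M 0%N k l * M 6%N 0%N l) 0%N k) => // l x ln.
rewrite (@den_fill_row _ 3%N 0%N _ _ _ m _ _
  (fun k => M 3%N 0%N k * reweight (M 10%N 0%N 0%N) (z k))) //; last first.
  move=> k km; rewrite den_LSet /=; congr upd_mem.
  by rewrite /fill_row /upd_env /= ltnn km /reweight expr2.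
rewrite /weights /fill_row /= ltn_ord; congr (_ * reweight _ _).
by apply: eq_bigr => l _; rewrite !mxE MV.
Qed.

Lemma step_progP M : holds_input V M ->
  (forall i, dotp (row i V) (row i V) = 1) ->
  (forall i, 0 < wt M i) -> 0 < M 11%N 0%N 0%N ->
  0 < n%:R - 2 - (\sum_i wt M i) / M 11%N 0%N 0%N ->
  walk_step V (M 10%N 0%N 0%N) (M 11%N 0%N 0%N) (rv M 2) (wt M)
    (rv (den step_prog g M) 2) (wt (den step_prog g M)).
Proof.
move=> MV V1 w0 th0 d0; rewrite /step_prog.
rewrite den_LSeq; set M1 := den identity_prog g M.
rewrite den_LSeq; set M2 := den (project_prog _) g M1.
rewrite den_LSeq; set M3 := den gradient_prog g M2.
rewrite den_LSeq; set M4 := den (project_prog _) g M3.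
rewrite den_LSeq; set M5 := den freeze_prog g M4.
rewrite den_LSeq; set M6 := den totals_prog g M5.
rewrite den_LSeq; set M7 := den search_prog g M6.
rewrite den_LSeq; set M8 := den move_prog g M7.
(* The arrays changed before [x] and the weights are updated. *)
pose touched : seq nat := [:: 4; 5; 6; 7; 8; 12; 13; 14; 15]%N.
have keep p M' : all [in touched] (writes p) ->
    (forall a, a \notin touched -> M' a = M a) ->
    forall a, a \notin touched -> den p g M' a = M a.
  move=> /allP sub h a ha; rewrite den_frame ?h //.
  by apply: contra ha; exact: sub.
have fr1 : forall a, a \notin touched -> M1 a = M a by exact: keep.
have fr2 : forall a, a \notin touched -> M2 a = M a by exact: keep.
have fr3 : forall a, a \notin touched -> M3 a = M a by exact: keep.
have fr4 : forall a, a \notin touched -> M4 a = M a by exact: keep.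
have fr5 : forall a, a \notin touched -> M5 a = M a by exact: keep.
have fr6 : forall a, a \notin touched -> M6 a = M a by exact: keep.
have fr7 : forall a, a \notin touched -> M7 a = M a by exact: keep.
have MV_ M' : (forall a, a \notin touched -> M' a = M a) -> holds_input V M'.
  by move=> h i j; rewrite h.
have wt_ M' : (forall a, a \notin touched -> M' a = M a) -> wt M' = wt M.
  by move=> h; apply/funext => i; rewrite /weights h.
have mx_ M' M'' : M' 4%N = M'' 4%N -> mx M' 4 = mx M'' 4 by rewrite /mx_of => ->.
have P1 : mx M1 4 = 1%:M by apply: identity_progP.
have pr1 : is_proj (mx M1 4) by rewrite P1; split; [rewrite trmx1|rewrite mulmx1].
have P2 : mx M2 4 = project_out (mx M1 4) (rv M 2).
  by apply: project_progP => // j k M' kn h; rewrite /= h // fr1.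
have P3 : mx M3 4 = mx M2 4 by apply: mx_; apply: den_frame.
have G3 : rv M3 7 = \sum_i wt M i *: row i V.
  by rewrite -(wt_ _ fr2); apply: gradient_progP => //; exact: MV_.
have P4 : mx M4 4 = project_out (mx M3 4) (rv M3 7).
  by apply: project_progP => // j k M' kn h; rewrite /= h.
have pr2 : is_proj (mx M2 4) by rewrite P2; exact: project_out_is_proj.
have pr4 : is_proj (mx M4 4) by rewrite P4 P3; exact: project_out_is_proj.
have [||||pr5 ke5 fz5 tr5] := @freeze_progP M4;
  rewrite ?(wt_ _ fr4) ?fr4 //.
  exact: MV_.
rewrite (wt_ _ fr4) fr4 // -/M5 in pr5 ke5 fz5 tr5.
have x5 : rv M 2 *m mx M5 4 = 0.
  apply: ke5; rewrite P4; apply: mulmx_project_out_eq0; rewrite ?P3 //.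
  by rewrite P2; exact: mulmx_project_out.
have g5 : (\sum_i wt M i *: row i V) *m mx M5 4 = 0.
  by apply: ke5; rewrite -G3 P4; apply: mulmx_project_out; rewrite P3.
have tr_ge : n%:R - 2 - (\sum_i wt M i) / M 11%N 0%N 0%N <= \tr (mx M5 4).
  have t2 := mxtrace_project_out (mx M1 4) (rv M 2).
  have t4 := mxtrace_project_out (mx M3 4) (rv M3 7).
  rewrite -P2 P1 mxtrace1 in t2; rewrite -P4 P3 in t4.
  by move: t2 t4 tr5; lra.
have tr_gt0 : 0 < \tr (mx M5 4) by exact: lt_le_trans tr_ge.
have [T6 F6] := totals_progP M5; rewrite -/M6 (wt_ _ fr5) in T6 F6.
have P6 : mx M6 4 = mx M5 4 by apply: mx_; apply: den_frame.
have [|j [[Pj Qj] Yj]] := search_progP (MV_ _ fr6).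
  have w0' i : 0 <= wt M i by exact: ltW.
  have [j [Pj Qj]] := exists_low_variance_row pr5 w0' V1 tr_gt0.
  by exists j; rewrite (wt_ _ fr6) P6 T6 F6.
rewrite (wt_ _ fr6) P6 T6 F6 -/M7 in Pj Qj Yj.
set P := mx M5 4 in pr5 ke5 fz5 tr5 x5 g5 tr_ge tr_gt0 T6 P6 Pj Qj Yj.
have {Yj} [s ss Yj] : exists2 s, s ^+ 2 = (P j j)^-1 & rv M7 6 = s *: row j P.
  by exists (Num.sqrt (P j j))^-1; rewrite // exprVn sqr_sqrtr // ltW.
have dotpY (c : 'rV_n) : dotp c (rv M7 6) = s * (c *m P) 0 j.
  by rewrite Yj dotpZr dotp_row_proj.
exists (rv M7 6); split; last first.
  split.
    have -> : rv (den reweight_prog g M8) 2 = rv M8 2.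
      by apply/rowP => l; rewrite !mxE den_frame.
    rewrite move_progP; congr (_ + _).
    by apply/rowP => l; rewrite !mxE fr7.
  move=> i; have MV8 : holds_input V M8.
    by move=> i' l; rewrite /M8 den_frame //; apply: MV_ fr7 _ _.
  rewrite (reweight_progP MV8) (_ : M8 10%N = M 10%N); last first.
    by rewrite /M8 den_frame // fr7.
  have -> : wt M8 i = wt M i by rewrite /weights /M8 den_frame // fr7.
  by have -> : rv M8 6 = rv M7 6 by apply/rowP => l; rewrite !mxE /M8 den_frame.
split.
- rewrite Yj dotpZr dotpC dotpZr dotp_row_proj_self // mulrA -expr2 ss.
  by rewrite mulVf ?gt_eqF.
- by rewrite dotpY x5 mxE mulr0.
- under eq_bigr do rewrite dotpY mulrCA.
  rewrite -mulr_sumr; have /rowP/(_ j) := g5; rewrite mulmx_suml summxE mxE => e.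
  rewrite (_ : \sum_i _ = 0) ?mulr0 // -[RHS]e.
  by apply: eq_bigr => i _; rewrite -scalemxAl [RHS]mxE.
- by move=> i /fz5; rewrite dotpY => ->; rewrite mxE mulr0.
(* Normalising divides the moment by [P j j], so the test passed by row [j] is the claim with the
   trace in place of its lower bound. *)
- under eq_bigr do rewrite Yj dotpZr exprMn mulrCA ss.
  rewrite -mulr_sumr -mulrA mulrC ler_pdivrMr //; apply: le_trans Qj.
  rewrite ler_wpM2l //; apply: sumr_ge0 => i _.
  by rewrite mulr_ge0 ?sqr_ge0 // ltW.
Qed.

End Step.

(** * Correctness of the whole run *)

Section Run.
Variables (R : realType) (m n : nat) (V : 'M[R]_(m, n)).
Implicit Types (M : memory R).

Local Notation rv := (@rv_of R n).
Local Notation wt := (@weights R m).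

Lemma setup_progP g M : g 0%N = m -> g 1%N = n -> (0 < n)%N -> (n <= m)%N ->
  let M' := den setup_prog g M in
  [/\ forall i : 'I_m, wt M' i = 1, M' 10%N 0%N 0%N = step_size R m n
    & M' 11%N 0%N 0%N = freeze_threshold R m n].
Proof.
move=> g0 g1 n0 nm M'.
have HE : \sum_(k < m) (1 - (n - k))%N%:R / k%:R = harmonic_gap R m n.
  rewrite /harmonic_gap (big_nat_widenl _ 0%N) // big_mkord [RHS]big_mkcond /=.
  apply: eq_bigr => k _; case: leqP => [nk|kn].
    by rewrite (_ : 1 - (n - k) = 1)%N ?mul1r //; lia.
  by rewrite (_ : 1 - (n - k) = 0)%N ?mul0r //; lia.
rewrite /M' /setup_prog den_LSeq (@den_fill_row _ 3%N 0%N _ _ _ m _ _ (fun=> 1)) //.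
rewrite den_LSeq (@den_LSum _ 9%N _ _ _ _ _ m _ _
  (fun k => (1 - (n - k))%N%:R / k%:R) 0%N 0%N) //; last first.
  by move=> k x km /=; rewrite /upd_env /= g1.
rewrite HE den_LSeq !den_LSet /= g0 g1; split.
- by move=> i; rewrite /weights /upd_mem /fill_row /= ltn_ord.
- by rewrite /upd_mem /= /step_size; congr (Num.sqrt (_ / _)); ring.
- by rewrite /upd_mem /= /freeze_threshold /freeze_factor expr2.
Qed.

Definition walk_state t M : Prop :=
  [/\ holds_input V M, M 10%N 0%N 0%N = step_size R m n,
      M 11%N 0%N 0%N = freeze_threshold R m n
    & walk_inv V (step_size R m n) (freeze_threshold R m n) t (rv M 2) (wt M)].

Hypotheses (n8 : (8 <= n)%N) (nm : (16 * n <= m)%N).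
Hypothesis small : 2 * ln (m%:R / n%:R) < n%:R :> R.
Hypothesis V1 : forall i, dotp (row i V) (row i V) = 1.

Let n0 : (0 < n)%N. Proof. exact: leq_trans n8. Qed.

Lemma step_prog_walk_state g t M : g 0%N = m -> g 1%N = n ->
  (t < n ^ 4)%N -> walk_state t M -> walk_state t.+1 (den step_prog g M).
Proof.
move=> g0 g1 tT [MV e th I].
have th1 := freeze_threshold_ge1 R n0 nm.
have th0 : 0 < freeze_threshold R m n by exact: lt_le_trans th1.
have fz := walk_inv_frozen n8 (step_size_gt0 R n0 nm) th1
  (growth_budget n0 nm n8 small) (ltnW tT) I.
have w0 i : 0 < wt M i by case: I => _ /(_ i)/andP[].
have st : walk_step V (M 10%N 0%N 0%N) (M 11%N 0%N 0%N) (rv M 2) (wt M)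
    (rv (den step_prog g M) 2) (wt (den step_prog g M)).
  apply: step_progP => //; rewrite th //.
  have nR : 8 <= n%:R :> R by rewrite (ler_nat R 8).
  have n0R : 0 < n%:R :> R by apply: lt_le_trans nR.
  move: fz; rewrite mulrAC ler_pdivrMr ?(mulr_gt0 th0 n0R) // => fz.
  (* With [F / theta <= n / 6] and [8 <= n], some direction is left: [n - 2 - F / theta > 0]. *)
  have : (\sum_i wt M i) / freeze_threshold R m n <= n%:R / 6.
    rewrite ler_pdivrMr //; move: fz; lra.
  by move: nR; lra.
rewrite e th in st.
have fr a : a \notin writes step_prog -> den step_prog g M a = M a by exact: den_frame.
split; rewrite ?fr //.
  by move=> i j; rewrite fr.
exact: (walk_inv_step n8 V1 (step_size_gt0 R n0 nm)
  (step_size_le1 n0 nm n8 small) th1 (growth_budget n0 nm n8 small) tT I st).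
Qed.

(** Treats the nested loops uniformly: each multiplies the number of steps by [n]. The horizon
    [n ^ 4] is included because the weights are controlled only up to then. *)
Definition advances (N : nat) (p : lprog) : Prop :=
  forall g t M, g 0%N = m -> g 1%N = n -> (t + N <= n ^ 4)%N ->
  walk_state t M -> walk_state (t + N) (den p g M).

Lemma advances_LFor N p r : (1 < r)%N -> advances N p ->
  advances (n * N) (LFor r 1 p).
Proof.
move=> r1 H g t M g0 g1 tN J.
pose I k M' := walk_state (t + k * N) M'.
have : I (g 1%N) (den (LFor r 1 p) g M).
  apply: den_LFor_ind; rewrite /I; first by rewrite mul0n addn0.
  move=> k M' kn J'; rewrite mulSn addnCA addnC; apply: H => //.
  - by rewrite /upd_env; case: r r1.
  - by rewrite /upd_env; case: r r1 => // -[].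
  - rewrite g1 in kn; apply: leq_trans tN.
    by rewrite -addnA leq_add2l -mulSnr leq_mul2r kn orbT.
by rewrite /I g1.
Qed.

Lemma walk_progP g M : g 0%N = m -> g 1%N = n ->
  walk_state 0 M -> walk_state (n ^ 4) (den walk_prog g M).
Proof.
have st : advances 1 step_prog.
  by move=> g' t M' ? ?; rewrite addn1; exact: step_prog_walk_state.
have := advances_LFor (r := 2) isT (advances_LFor (r := 3) isT
  (advances_LFor (r := 4) isT (advances_LFor (r := 5) isT st))).
have -> : (n * (n * (n * (n * 1))) = n ^ 4)%N by rewrite !expnS.
by move=> A g0 g1; apply: A.
Qed.

End Run.

Lemma output_progP (R : realType) n g (M : memory R) : g 1%N = n -> (0 < n)%N ->
  (forall j, M 1%N 0%N j = 0) ->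
  let x := rv_of n M 2 in
  let x' := rv_of n (den output_prog g M) 1 in
  dotp x' x' = 1 /\ (dotp x x = 1 -> x' = x).
Proof.
move=> g1 n0 M1; set x := rv_of n M 2.
rewrite /output_prog den_LSeq (@den_LSum _ 16%N _ _ _ _ _ n _ _
  (fun k => M 2%N 0%N k * M 2%N 0%N k) 0%N 0%N) //.
have NE : \sum_(k < n) M 2%N 0%N k * M 2%N 0%N k = dotp x x.
  by apply: eq_bigr => k _; rewrite !mxE.
rewrite NE; set M' := upd_mem _ _ _ _ _.
rewrite den_LIf.
have -> : beval (Store g M') (BRealLe (rscalar 16) (RNum 0)) = (dotp x x <= 0).
  by rewrite /= /M' /upd_mem.
case: ifPn => x0.
  split; last by move=> x1; rewrite x1 ler10 in x0.
  rewrite den_LSet /= /dotp (bigD1 (Ordinal n0)) //= big1 ?addr0.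
    by rewrite mxE /upd_mem /= mulr1.
  move=> j j0; rewrite mxE /upd_mem /= /M' /upd_mem /= M1.
  by rewrite (_ : (j == 0 :> nat) = false) ?mul0r //; apply/negbTE.
rewrite -ltNge in x0.
rewrite (@den_fill_row _ 1%N 0%N _ _ _ n _ _
  (fun k => M 2%N 0%N k / Num.sqrt (dotp x x))) //.
rewrite rv_of_fill_row.
have -> : \row_(j < n) (M 2%N 0%N j / Num.sqrt (dotp x x)) =
    (Num.sqrt (dotp x x))^-1 *: x.
  by apply/rowP => j; rewrite !mxE mulrC.
split; last by move=> ->; rewrite sqrtr1 invr1 scale1r.
rewrite dotpZr dotpC dotpZr mulrA -expr2 exprVn sqr_sqrtr ?(ltW x0) //.
by rewrite mulVf ?gt_eqF.
Qed.

Lemma norm2_eq1 (R : realType) n (u : 'rV[R]_n) : on_sphere u <-> dotp u u = 1.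
Proof.
rewrite /on_sphere /norm2; split=> [u1|->]; last by rewrite sqrtr1.
by rewrite -(sqr_sqrtr (dotp_ge0 u)) u1 expr1n.
Qed.

Theorem theorem5 (R : realType) :
  exists (p : prog) (k : nat) (C : R),
    0 < C /\
    forall (m n : nat) (V : 'M[R]_(m, n)),
      exists (t : nat) (s : store R),
        [/\ exec p (input_store V) t s,
            (t <= k * (m + n + 1) ^ k)%N
          & (0 < n)%N -> (16 * n <= m)%N ->
            (forall i : 'I_m, on_sphere (row i V)) ->
            on_sphere (output_vector n s) /\
            forall i : 'I_m,
              dotp (row i V) (output_vector n s) <=
                Num.sqrt (2 * ln (m%:R / n%:R) / n%:R) *
                (1 + C / log2 (m%:R / n%:R))].
Proof.
(* The sum [coef + depth] serves both as factor and as exponent of the time bound. *)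
exists (compile main_prog), (coef main_prog + depth main_prog)%N, (error_constant R).
split; first exact: error_constant_gt0.
move=> m n V; set g := nreg (input_store V).
have [|||t [s [Ex mE _ tE]]] :=
  @exec_compile R (m + n + 1) main_prog [:: 0; 1]%N (input_store V) g.
- by [].
- by [].
- by case=> [|[|b]] // _; rewrite /g /= addn1 ltnS ?leq_addr ?leq_addl.
exists t, s; split=> //.
  apply: (leq_trans tE); apply: leq_mul; first exact: leq_addr.
  by rewrite leq_pexp2l ?leq_addl // addn1.
move=> n0 nm V1.
have {}V1 i : dotp (row i V) (row i V) = 1 by apply/norm2_eq1.
have g0 : g 0%N = m by [].
have g1 : g 1%N = n by [].
set M0 := rmem (input_store V) in mE.
pose M1 := den setup_prog g M0; pose M2 := den walk_prog g M1.
have outE : output_vector n s = rv_of n (den output_prog g M2) 1.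
  by rewrite /output_vector mE.
have [|o1 ox] := @output_progP R n g M2 g1 n0.
  by move=> j; rewrite /M2 /M1 !den_frame.
rewrite outE; split; first exact/norm2_eq1.
move=> i.
(* In the first case the bound is at least 1, and Cauchy-Schwarz suffices whatever the walk did. *)
have [big|] := boolP ((n < 8)%N || (n%:R <= 2 * ln (m%:R / n%:R) :> R)).
  apply: le_trans (bound_ge1 n0 nm big).
  exact: le_trans (ler_norm _) (CauchySchwarz_unit (V1 i) o1).
rewrite negb_or -leqNgt -ltNge => /andP[n8 small].
have nm1 : (n <= m)%N by lia.
have [w1 e1 th1] := @setup_progP R m n g M0 g0 g1 n0 nm1.
have J : walk_state V (n ^ 4) M2.
  apply: walk_progP => //; split=> //.
    by move=> i' j; rewrite /M1 den_frame // /M0 /= !valK.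
  apply: walk_inv0 => //; first exact: freeze_threshold_ge1.
  by apply/rowP => j; rewrite !mxE /M1 den_frame.
case: J => _ _ _ I.
(* After [n ^ 4] steps the squared norm of [x] is exactly 1, so normalisation leaves [x]
   unchanged. *)
rewrite ox; first exact: walk_inv_bound I i.
by case: I => -> _ _ _; rewrite natrX divff // expf_neq0 // pnatr_eq0; lia.
Qed.
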